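(* Let $p\in\mathbb{C}[z_1,z_2]$ be a polynomial that is stable on $\overline{\mathbb{D}^2}$ (i.e. has no zeros on $\overline{\mathbb{D}^2}$), let $\varphi=\frac{\tilde p}{p}$, and let $\Phi=(\varphi,\varphi)\in\mathcal{O}(\mathbb{D}^2,\mathbb{D}^2)$. Then, for all $\beta>4$, the composition operator $C_\Phi: A^2_{\frac{\beta}{2}-2}(\mathbb{D}^2)\to A^2_\beta(\mathbb{D}^2)$ is bounded.
   Context: $\mathbb{D}^2=\{(z_1,z_2)\in\mathbb{C}^2:|z_1|<1,|z_2|<1\}$ is the bidisc; $\mathcal{O}(\Omega_1,\Omega_2)$ is the class of holomorphic maps $\Omega_1\to\Omega_2$. For $p\in\mathbb{C}[z_1,z_2]$ of bidegree $(n,m)$, the reflection is $\tilde p(z)=z_1^nz_2^m\overline{p(1/\overline{z_1},1/\overline{z_2})}$. The weighted Bergman space $A^2_\beta(\mathbb{D}^2)$ consists of the holomorphic $f:\mathbb{D}^2\to\mathbb{C}$ with $\int_{\mathbb{D}^2}|f(z_1,z_2)|^2(1-|z_1|^2)^\beta(1-|z_2|^2)^\beta\,dA(z_1)dA(z_2)<\infty$, with the norm given by the square root of this integral, where $dA=\frac1\pi dx\,dy$. The composition operator is $C_\Phi f=f\circ\Phi$. ''$C_\Phi:X\to Y$ is bounded'' means that $C_\Phi$ maps $X$ into $Y$ and is a bounded linear operator. *)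

(* Defs.v *)
From HB Require Import structures.
From mathcomp Require Import all_boot all_order all_algebra.
From mathcomp Require Import polyXY complex ring.
From mathcomp Require Import all_classical all_reals all_analysis.

Set Implicit Arguments.
Unset Strict Implicit.
Unset Printing Implicit Defensive.

Import Order.TTheory GRing.Theory Num.Theory.
Import numFieldNormedType.Exports.

Local Open Scope classical_set_scope.
Local Open Scope ring_scope.
Local Open Scope complex_scope.

(* The regular algebra R[i]^o carries the normed-module structure of R[i] over
   itself, so that [differentiable] between powers of it is complex (Frechet)
   differentiability. *)
Notation Cplx R := ((R[i])^o).
Notation Cplx2 R := (Cplx R * Cplx R)%type.

Section Holomorphic.
Variable R : realType.

Definition bidisc : set (Cplx2 R) := [set z | `|z.1| < 1 /\ `|z.2| < 1].
Definition closed_bidisc : set (Cplx2 R) := [set z | `|z.1| <= 1 /\ `|z.2| <= 1].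

Definition holomorphic_map (V W : normedModType R[i]) (A : set V) (B : set W)
    (f : V -> W) : Prop :=
  (forall z, A z -> differentiable f z) /\ (forall z, A z -> B (f z)).

End Holomorphic.
Arguments bidisc R : clear implicits.
Arguments closed_bidisc R : clear implicits.

(* Following polyXY, p : {poly {poly C}} is a polynomial in (z1, z2) with z1 the
   outer and z2 the inner variable: p`_j`_k is the coefficient of z1^j z2^k. *)
Section Polynomials.
Variable R : realType.
Implicit Types p : {poly {poly R[i]}}.

Definition peval p (z : Cplx2 R) : Cplx R := p.[z.1, z.2].

Definition stable p : Prop := forall z, closed_bidisc R z -> peval p z != 0.

Definition bidegree p : nat * nat := ((size p).-1, (sizeY p).-1).

(* The defining formula of the reflection only makes sense for z1, z2 <> 0; this
   is the polynomial that it determines, see [peval_reflection]. *)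
Definition reflection p : {poly {poly R[i]}} :=
  let: (n, m) := bidegree p in
  \poly_(j < n.+1) \poly_(k < m.+1) conjc p`_(n - j)`_(m - k).

Lemma peval_sum n m (c : nat -> nat -> R[i]) (x y : R[i]) :
  (\poly_(j < n) \poly_(k < m) c j k).[x, y] =
  \sum_(j < n) \sum_(k < m) c j k * x ^+ j * y ^+ k.
Proof.
rewrite horner_poly horner_sum; apply: eq_bigr => j _.
rewrite hornerM horner_poly -rmorphXn /= hornerC mulr_suml.
by apply: eq_bigr => k _; rewrite mulrAC.
Qed.

Lemma bidegree_poly p : let: (n, m) := bidegree p in
  p = \poly_(j < n.+1) \poly_(k < m.+1) p`_j`_k.
Proof.
rewrite /bidegree; apply/polyP => j; apply/polyP => k.
rewrite coef_poly; case: ltnP => [_|lt_nj].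
  rewrite coef_poly; case: ltnP => // lt_mk; rewrite nth_default//.
  by apply: leq_trans (max_size_coefXY _ _) (leq_trans (leqSpred _) lt_mk).
by rewrite (nth_default 0 (leq_trans (leqSpred _) lt_nj)).
Qed.

Lemma peval_reflection p (x y : R[i]) : x != 0 -> y != 0 ->
  let: (n, m) := bidegree p in
  peval (reflection p) (x, y) =
  x ^+ n * y ^+ m * conjc (peval p ((conjc x)^-1, (conjc y)^-1)).
Proof.
move=> x0 y0; rewrite /reflection /peval /=.
move: (bidegree_poly p) => /=; move: (size p).-1 (sizeY p).-1 => n m defp.
rewrite [p in RHS]defp !peval_sum.
rewrite (reindex_inj rev_ord_inj)/= rmorph_sum mulr_sumr.
apply: eq_bigr => j _; rewrite (reindex_inj rev_ord_inj)/= rmorph_sum mulr_sumr.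
apply: eq_bigr => k _; rewrite !rmorphM !rmorphXn !fmorphV !subSS.
rewrite [in RHS]/= !conjcK.
have le_jn : (j <= n)%N by rewrite -ltnS.
have le_km : (k <= m)%N by rewrite -ltnS.
rewrite !subKn// !expfB_cond ?(negbTE x0) ?(negbTE y0) ?addn0// !exprVn.
by ring.
Qed.

Definition rational_inner p (z : Cplx2 R) : Cplx R :=
  (peval (reflection p) z : R[i]) / peval p z.

End Polynomials.

Section Bergman.
Variable R : realType.
Notation leb := (@lebesgue_measure R).

Definition cplx2_of (w : (R * R) * (R * R)) : Cplx2 R :=
  (w.1.1 +i* w.1.2, w.2.1 +i* w.2.2).

Definition weight (beta : R) (z : Cplx2 R) : R :=
  (1 - Normc.normc z.1 ^+ 2) `^ beta * (1 - Normc.normc z.2 ^+ 2) `^ beta.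

(* The factor pi ^- 2 is the normalisation dA = dx dy / pi in each variable. *)
Definition bergman_integral (beta : R) (f : Cplx2 R -> Cplx R) : \bar R :=
  ((pi ^- 2)%:E *
   \int[(leb \x leb) \x (leb \x leb)]_(w in cplx2_of @^-1` bidisc R)
     (Normc.normc (f (cplx2_of w)) ^+ 2 * weight beta (cplx2_of w))%:E)%E.

Definition bergman (beta : R) : set (Cplx2 R -> Cplx R) :=
  [set f | holomorphic_map (bidisc R) setT f /\ (bergman_integral beta f < +oo)%E].

Definition bergman_norm (beta : R) (f : Cplx2 R -> Cplx R) : R :=
  Num.sqrt (fine (bergman_integral beta f)).

Definition composition_operator (Phi : Cplx2 R -> Cplx2 R)
  (f : Cplx2 R -> Cplx R) : Cplx2 R -> Cplx R := f \o Phi.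

(* Elements of the spaces are total functions of which only the values on the
   bidisc matter, so identities between them are required on the bidisc. *)
Definition bounded_bergman_operator (alpha beta : R)
    (T : (Cplx2 R -> Cplx R) -> (Cplx2 R -> Cplx R)) : Prop :=
  [/\ forall f, bergman alpha f -> bergman beta (T f),
      forall (a : R[i]) f g, bergman alpha f -> bergman alpha g ->
        forall z, bidisc R z -> T (a *: f + g) z = a *: T f z + T g z &
      exists M : R, forall f, bergman alpha f ->
        bergman_norm beta (T f) <= M * bergman_norm alpha f].

End Bergman.

(* Main.v *)
From HB Require Import structures.
Require Import Defs.
From mathcomp Require Import all_boot all_order all_algebra.
From mathcomp Require Import polyXY complex ring lra.
From mathcomp Require Import all_classical all_reals all_analysis.
From mathcomp Require Import measurable_realfun.

(** Write phi for the rational function and d(z) = 1 - |phi(z)|. Two estimates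
    meet with matching exponents.

    Point evaluations on the space of weight alpha = beta/2 - 2 satisfy
    |f(a,b)|^2 <= C ((1-|a|)(1-|b|))^-(alpha+2) ||f||^2, so at the point
    (phi(z), phi(z)) of the diagonal |f|^2 is at most C d(z)^-beta times the
    squared norm, because 2(alpha+2) = beta ([bergman_point_evaluation]).
    On the other side, d(z) >= c (1-|z1|)(1-|z2|) for some c > 0
    ([one_sub_inner_ge]), so the weight of the target space is at most
    C' d(z)^beta. The integrand defining the norm of f o Phi is therefore
    bounded on the bidisc by a constant multiple of the squared norm of f
    ([composition_pointwise]), and the bidisc has finite volume.

    The point evaluation is the mean value inequality
    r^2/4 |f(a)|^2 <= (integral of |f|^2 over the square of half-side r)
    ([square_mean_value]), used once in each variable. Complex
    differentiability is only pointwise here, so the inequality starts from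
    Goursat's theorem ([goursat]): the integral of f^2(z) dz/(z-a) is the same
    over all rectangles around a, shrinking them shows that it is at least
    4 |f(a)|^2 in modulus, and on a rectangle whose sides pass at distance r/2
    or more from a it is at most 2/r times the integrals of |f|^2 along the
    sides. Each of the four sides can be chosen so that its integral does not
    exceed the average over an interval of length r/2. Taking f^2 in place of f
    gives the square of the modulus without the Cauchy-Schwarz inequality.

    The bound on d is Schwarz's lemma without its sharp constant. Let q < 1
    bound |phi| on the bidisc of radius 1/2 and pick N with 2 q^N <= 1. On a
    complex line through the origin phi^N/l is a quotient of one-variable
    polynomials, of modulus at most 1 on |l| = 1/2 and at most 1/r on |l| = r.
    The maximum principle on the annulus ([annulus_maximum_modulus]) gives
    |phi|^N <= max(|z1|,|z2|) outside that smaller bidisc, and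
    1 - |phi|^N <= N (1 - |phi|). *)

Set Implicit Arguments.
Unset Strict Implicit.
Unset Printing Implicit Defensive.
Import Order.TTheory GRing.Theory Num.Theory.
Import numFieldNormedType.Exports.
Local Open Scope classical_set_scope.
Local Open Scope ring_scope.
Local Open Scope complex_scope.
Import Normc.
Local Notation Re := complex.Re.
Local Notation Im := complex.Im.

(** * Integrals of continuous functions over segments *)

Section IntervalIntegral.
Variable R : realType.
Implicit Types (f g : R -> R) (a b : R).

Definition itvint a b f : R := Rintegral (@lebesgue_measure R) `[a, b] f.

Definition continuous_on a b f :=
  forall x, a <= x <= b -> {for x, continuous f}.

Lemma continuous_on_integrable a b f : continuous_on a b f ->
  (@lebesgue_measure R).-integrable `[a, b] (EFin \o f).
Proof.
move=> cf; apply: continuous_compact_integrable; first exact: segment_compact.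
apply: continuous_in_subspaceT => x; rewrite inE/= in_itv/= => xab.
exact: cf.
Qed.

Lemma continuous_onS a b c d f : a <= c -> d <= b ->
  continuous_on a b f -> continuous_on c d f.
Proof.
move=> ac db cf x /andP[cx xd]; apply: cf.
by rewrite (le_trans ac cx) (le_trans xd db).
Qed.

Lemma itvintB a b f g : continuous_on a b f -> continuous_on a b g ->
  itvint a b f - itvint a b g = itvint a b (fun x => f x - g x).
Proof.
by move=> cf cg; rewrite /itvint RintegralB//; exact: continuous_on_integrable.
Qed.

Lemma itvint_cst a b k : a <= b -> itvint a b (fun=> k) = k * (b - a).
Proof.
move=> ab; rewrite /itvint Rintegral_cst//= lebesgue_measure_itv/= lte_fin.
by case: ltgtP ab => // -> _; rewrite subrr.
Qed.

Lemma le_itvint a b f g : continuous_on a b f -> continuous_on a b g ->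
  (forall x, a <= x <= b -> f x <= g x) -> itvint a b f <= itvint a b g.
Proof.
move=> cf cg fg; apply: le_Rintegral => //; try exact: continuous_on_integrable.
Qed.

Lemma continuous_on_cst a b k : continuous_on a b (fun=> k).
Proof. by move=> x _; exact: cvg_cst. Qed.

Lemma itvint_norm_le a b f M : a <= b -> continuous_on a b f ->
  (forall x, a <= x <= b -> `|f x| <= M) -> `|itvint a b f| <= M * (b - a).
Proof.
move=> ab cf fM; rewrite ler_norml -mulNr -!itvint_cst//.
apply/andP; split; apply: le_itvint => //; try exact: continuous_on_cst.
  by move=> x /fM; rewrite ler_norml => /andP[].
by move=> x /fM; rewrite ler_norml => /andP[].
Qed.

Lemma itvint_split a m b f : a <= m -> m <= b -> continuous_on a b f ->
  itvint a b f = itvint a m f + itvint m b f.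
Proof.
move=> am mb cf; have If := continuous_on_integrable cf.
have /(_ m) := Rintegral_itvB If; rewrite !bnd_simp => /(_ am mb) /eqP.
rewrite subr_eq => /eqP; rewrite /itvint => ->.
rewrite addrC Rintegral_itv_obnd_cbnd//.
apply: (integrableS _ _ _ If) => //; apply: subset_itvr; rewrite bnd_simp//.
Qed.

End IntervalIntegral.

(** * Goursat's theorem for closed real 1-forms *)

Section Goursat.
Variable R : realType.
Implicit Types (P Q : R -> R -> R).

(** First-order differentiability of the form P dx + Q dy at one point,
    closedness being the shared coefficient b of dy in dP and of dx in dQ. No
    continuity of a, b, c in the base point is asked for, which is what Goursat's
    theorem can do without. *)
Definition closed_form_at P Q (x0 y0 : R) := exists a b c : R,
  forall e, 0 < e -> exists2 d, 0 < d & forall x y,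
    `|x - x0| < d -> `|y - y0| < d ->
    `|P x y - P x0 y0 - (a * (x - x0) + b * (y - y0))|
      <= e * (`|x - x0| + `|y - y0|) /\
    `|Q x y - Q x0 y0 - (b * (x - x0) + c * (y - y0))|
      <= e * (`|x - x0| + `|y - y0|).

Definition closed_form_on P Q (x1 x2 y1 y2 : R) := forall x y,
  x1 <= x <= x2 -> y1 <= y <= y2 -> closed_form_at P Q x y.

Definition boundary_int P Q (x1 x2 y1 y2 : R) : R :=
  itvint x1 x2 (P ^~ y1) + itvint y1 y2 (Q x2)
  - itvint x1 x2 (P ^~ y2) - itvint y1 y2 (Q x1).

Lemma lipschitz_at_continuous (f : R -> R) (x0 k : R) :
  (exists2 d, 0 < d & forall x, `|x - x0| < d -> `|f x - f x0| <= k * `|x - x0|) ->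
  {for x0, continuous f}.
Proof.
move=> [d d0 H]; apply/cvgrPdist_lt => e e0; near=> x.
have k0 : 0 < `|k| + 1 by rewrite ltr_wpDl.
rewrite distrC (@le_lt_trans _ _ ((`|k| + 1) * `|x - x0|))//.
  apply: (le_trans (H _ _)).
    near: x; apply/nbhs_ballP; exists d => //= x; rewrite /ball/= => h.
    by rewrite distrC.
  by rewrite ler_wpM2r// (le_trans (ler_norm k))// lerDl.
rewrite mulrC -ltr_pdivlMr//.
near: x; apply/nbhs_ballP; exists (e / (`|k| + 1)) => /=; first exact: divr_gt0.
by move=> x; rewrite /ball/= distrC.
Unshelve. all: by end_near. Qed.

Lemma closed_form_continuous P Q x0 y0 : closed_form_at P Q x0 y0 ->
  {for x0, continuous (P ^~ y0)} /\ {for y0, continuous (Q x0)}.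
Proof.
move=> [a [b [c /(_ 1 ltr01)[d d0 H]]]]; split.
  apply: (@lipschitz_at_continuous _ _ (1 + `|a|)); exists d => // x xd.
  have := (H x y0 xd); rewrite subrr normr0 => /(_ d0)[+ _].
  rewrite !mulr0 !addr0 mul1r mulrDl mul1r => h.
  rewrite -[X in `|X|](subrK (a * (x - x0))) (le_trans (ler_normD _ _))//.
  by rewrite normrM lerD2r.
apply: (@lipschitz_at_continuous _ _ (1 + `|c|)); exists d => // y yd.
have := (H x0 y); rewrite subrr normr0 => /(_ d0 yd)[_ +].
rewrite !mulr0 !add0r mul1r mulrDl mul1r => h.
rewrite -[X in `|X|](subrK (c * (y - y0))) (le_trans (ler_normD _ _))//.
by rewrite normrM lerD2r.
Qed.

Lemma closed_form_onS P Q x1 x2 y1 y2 x1' x2' y1' y2' :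
  x1 <= x1' -> x2' <= x2 -> y1 <= y1' -> y2' <= y2 ->
  closed_form_on P Q x1 x2 y1 y2 -> closed_form_on P Q x1' x2' y1' y2'.
Proof.
move=> h1 h2 h3 h4 H x y /andP[? ?] /andP[? ?]; apply: H; apply/andP; split.
- exact: le_trans h1 _.
- exact: le_trans h2.
- exact: le_trans h3 _.
- exact: le_trans h4.
Qed.

Lemma closed_form_ctsP P Q x1 x2 y1 y2 y : closed_form_on P Q x1 x2 y1 y2 ->
  y1 <= y <= y2 -> continuous_on x1 x2 (P ^~ y).
Proof. by move=> H yy x xx; have [] := closed_form_continuous (H x y xx yy). Qed.

Lemma closed_form_ctsQ P Q x1 x2 y1 y2 x : closed_form_on P Q x1 x2 y1 y2 ->
  x1 <= x <= x2 -> continuous_on y1 y2 (Q x).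
Proof. by move=> H xx y yy; have [] := closed_form_continuous (H x y xx yy). Qed.

Lemma boundary_int_splitx P Q x1 m x2 y1 y2 :
  x1 <= m -> m <= x2 -> y1 <= y2 -> closed_form_on P Q x1 x2 y1 y2 ->
  boundary_int P Q x1 x2 y1 y2 =
  boundary_int P Q x1 m y1 y2 + boundary_int P Q m x2 y1 y2.
Proof.
move=> xm mx yy H; rewrite /boundary_int.
rewrite (@itvint_split _ x1 m x2 (P ^~ y1))//; last first.
  by apply: (closed_form_ctsP H); rewrite lexx.
rewrite (@itvint_split _ x1 m x2 (P ^~ y2))//; last first.
  by apply: (closed_form_ctsP H); rewrite lexx andbT.
ring.
Qed.

Lemma boundary_int_splity P Q x1 x2 y1 m y2 :
  y1 <= m -> m <= y2 -> x1 <= x2 -> closed_form_on P Q x1 x2 y1 y2 ->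
  boundary_int P Q x1 x2 y1 y2 =
  boundary_int P Q x1 x2 y1 m + boundary_int P Q x1 x2 m y2.
Proof.
move=> xm mx yy H; rewrite /boundary_int.
rewrite (@itvint_split _ y1 m y2 (Q x1))//; last first.
  by apply: (closed_form_ctsQ H); rewrite lexx.
rewrite (@itvint_split _ y1 m y2 (Q x2))//; last first.
  by apply: (closed_form_ctsQ H); rewrite lexx andbT.
ring.
Qed.

(** The linear part of a closed form integrates to zero around a rectangle, so
    only the remainder is left: it is of smaller order than the size, over a
    boundary whose length is of the order of the size. *)
Lemma boundary_int_small P Q x0 y0 e : closed_form_at P Q x0 y0 -> 0 < e ->
  exists2 d, 0 < d & forall x1 x2 y1 y2,
    closed_form_on P Q x1 x2 y1 y2 -> x1 <= x0 <= x2 -> y1 <= y0 <= y2 ->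
    (x2 - x1) + (y2 - y1) < d ->
    `|boundary_int P Q x1 x2 y1 y2| <= e * ((x2 - x1) + (y2 - y1)) ^+ 2.
Proof.
move=> [a [b [c H]]] e0; have e20 : 0 <= e / 2 by rewrite divr_ge0// ltW.
have [|d d0 {}H] := H (e / 2); first by rewrite divr_gt0.
exists d => // x1 x2 y1 y2 cl /andP[x10 x02] /andP[y10 y02] sd.
have x12 := le_trans x10 x02; have y12 := le_trans y10 y02.
set s := (x2 - x1) + (y2 - y1) in sd *.
have Hpt x y : x1 <= x <= x2 -> y1 <= y <= y2 ->
   [/\ `|x - x0| < d, `|y - y0| < d & `|x - x0| + `|y - y0| <= s].
  move=> /andP[? ?] /andP[? ?].
  have hx : `|x - x0| <= x2 - x1 by rewrite ler_norml; lra.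
  have hy : `|y - y0| <= y2 - y1 by rewrite ler_norml; lra.
  by split; [move: sd; rewrite /s; lra| move: sd; rewrite /s; lra | rewrite lerD].
have hy1 : y1 <= y1 <= y2 by rewrite lexx.
have hy2 : y1 <= y2 <= y2 by rewrite lexx andbT.
have hx1 : x1 <= x1 <= x2 by rewrite lexx.
have hx2 : x1 <= x2 <= x2 by rewrite lexx andbT.
have cP1 := closed_form_ctsP cl hy1.
have cP2 := closed_form_ctsP cl hy2.
have cQ1 := closed_form_ctsQ cl hx1.
have cQ2 := closed_form_ctsQ cl hx2.
pose p x := P x y1 - P x y2 - (b * (y1 - y2)).
pose q y := Q x2 y - Q x1 y - (b * (x2 - x1)).
have cpq (k l : R) f g : continuous_on k l f -> continuous_on k l g ->
    continuous_on k l (fun x => f x - g x).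
  by move=> cf cg x xx; apply: cvgB; [exact: cf|exact: cg].
have -> : boundary_int P Q x1 x2 y1 y2 = itvint x1 x2 p + itvint y1 y2 q.
  rewrite /p /q.
  rewrite -(@itvintB _ _ _ (fun x => P x y1 - P x y2) (fun=> b * (y1 - y2))); last 2 first.
    exact: cpq.
    exact: continuous_on_cst.
  rewrite -(@itvintB _ _ _ (fun y => Q x2 y - Q x1 y) (fun=> b * (x2 - x1))); last 2 first.
    exact: cpq.
    exact: continuous_on_cst.
  rewrite -!itvintB// !itvint_cst// /boundary_int; ring.
have pe x : x1 <= x <= x2 -> `|p x| <= e * s.
  move=> xx; have [u1 v1 w1] := Hpt _ _ xx hy1; have [u2 v2 w2] := Hpt _ _ xx hy2.
  have [k1 _] := H _ _ u1 v1; have [k2 _] := H _ _ u2 v2.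
  have k1' := le_trans k1 (ler_wpM2l e20 w1).
  have k2' := le_trans k2 (ler_wpM2l e20 w2).
  rewrite [p x](_ : _ = (P x y1 - P x0 y0 - (a * (x - x0) + b * (y1 - y0))) -
     (P x y2 - P x0 y0 - (a * (x - x0) + b * (y2 - y0)))); last by rewrite /p; ring.
  rewrite (le_trans (ler_normB _ _))// (splitr e) mulrDl lerD//.
have qe y : y1 <= y <= y2 -> `|q y| <= e * s.
  move=> yy; have [u1 v1 w1] := Hpt _ _ hx1 yy; have [u2 v2 w2] := Hpt _ _ hx2 yy.
  have [_ k1] := H _ _ u1 v1; have [_ k2] := H _ _ u2 v2.
  have k1' := le_trans k1 (ler_wpM2l e20 w1).
  have k2' := le_trans k2 (ler_wpM2l e20 w2).
  rewrite [q y](_ : _ = (Q x2 y - Q x0 y0 - (b * (x2 - x0) + c * (y - y0))) -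
     (Q x1 y - Q x0 y0 - (b * (x1 - x0) + c * (y - y0)))); last by rewrite /q; ring.
  rewrite (le_trans (ler_normB _ _))// (splitr e) mulrDl lerD//.
have -> : e * s ^+ 2 = e * s * (x2 - x1) + e * s * (y2 - y1).
  by rewrite -mulrDr -/s; ring.
rewrite (le_trans (ler_normD _ _))// lerD//.
  apply: itvint_norm_le => //; apply: (cpq); [exact: cpq|exact: continuous_on_cst].
apply: itvint_norm_le => //; apply: (cpq); [exact: cpq|exact: continuous_on_cst].
Qed.

(** The integral over the boundary is the sum over the four quarters, so one
    quarter carries at least a fourth of it. *)
Lemma boundary_int_bisect P Q x y w h K : 0 <= w -> 0 <= h ->
  closed_form_on P Q x (x + w) y (y + h) ->
  K <= `|boundary_int P Q x (x + w) y (y + h)| ->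
  exists x' y', [/\ x <= x' <= x + w / 2, y <= y' <= y + h / 2 &
    K / 4 <= `|boundary_int P Q x' (x' + w / 2) y' (y' + h / 2)|].
Proof.
move=> w0 h0 cl KB.
have xm : x <= x + w / 2 <= x + w by apply/andP; split; lra.
have ym : y <= y + h / 2 <= y + h by apply/andP; split; lra.
case/andP: (xm) => xm1 xm2; case/andP: (ym) => ym1 ym2.
have yh : y <= y + h by lra.
have xw : x <= x + w by lra.
move: KB; rewrite (boundary_int_splitx xm1 xm2 yh cl).
rewrite (boundary_int_splity ym1 ym2 xm1); last exact: (closed_form_onS _ _ _ _ cl).
rewrite (boundary_int_splity ym1 ym2 xm2); last exact: (closed_form_onS _ _ _ _ cl).
have ex : x + w = x + w / 2 + w / 2 by lra.
have ey : y + h = y + h / 2 + h / 2 by lra.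
rewrite ex ey.
set B1 := boundary_int _ _ x _ y _; set B2 := boundary_int _ _ x _ _ _.
set B3 := boundary_int _ _ (x + _) _ y _; set B4 := boundary_int _ _ _ _ _ _.
move=> KB.
have : K <= `|B1| + `|B2| + (`|B3| + `|B4|).
  apply: (le_trans KB); apply: (le_trans (ler_normD _ _)).
  by apply: lerD; exact: ler_normD.
have [h1 _|h1] := leP (K / 4) `|B1|.
  by exists x, y; split => //; rewrite lexx.
have [h2 _|h2] := leP (K / 4) `|B2|.
  by exists x, (y + h / 2); split => //; rewrite lexx ?andbT.
have [h3 _|h3] := leP (K / 4) `|B3|.
  by exists (x + w / 2), y; split => //; rewrite lexx ?andbT.
have [h4 _|h4] := leP (K / 4) `|B4|.
  by exists (x + w / 2), (y + h / 2); split => //; rewrite lexx ?andbT.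
by move=> ?; exfalso; lra.
Qed.

Lemma nested_interval (x : nat -> R) (w : R) :
  0 <= w -> (forall n, x n <= x n.+1 /\ x n.+1 + w / 2 ^+ n.+1 <= x n + w / 2 ^+ n) ->
  exists l, forall n, x n <= l <= x n + w / 2 ^+ n.
Proof.
move=> w0 H.
have mono m n : (m <= n)%N -> x m <= x n.
  by apply: (homo_leq (r := <=%R)) => // [? ? ?|n']; [exact: le_trans|case: (H n')].
have anti m n : (m <= n)%N -> x n + w / 2 ^+ n <= x m + w / 2 ^+ m.
  apply: (homo_leq (f := fun n => x n + w / 2 ^+ n) (r := fun a b => b <= a)) => //.
    by move=> a b c ab bc; exact: le_trans bc ab.
  by move=> n'; case: (H n').
have ub m n : x m <= x n + w / 2 ^+ n.
  have wn k : 0 <= w / 2 ^+ k by rewrite divr_ge0// exprn_ge0.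
  have [mn|nm] := leqP m n; first by rewrite (le_trans (mono _ _ mn))// lerDl.
  by rewrite (le_trans _ (anti _ _ (ltnW nm)))// lerDl.
exists (sup (range x)) => n; apply/andP; split.
  apply: ub_le_sup; last by exists n.
  by exists (x 0%N + w / 2 ^+ 0) => _ [m _ <-].
apply: ge_sup; first by exists (x 0%N); exists 0%N.
by move=> _ [m _ <-].
Qed.

(** Bisection: a nonzero integral K propagates to nested rectangles as at least
    K/4^n, whereas [boundary_int_small] at their common point makes it
    negligible against 1/4^n. *)
Lemma goursat P Q x1 x2 y1 y2 : x1 <= x2 -> y1 <= y2 ->
  closed_form_on P Q x1 x2 y1 y2 -> boundary_int P Q x1 x2 y1 y2 = 0.
Proof.
move=> x12 y12 cl; apply/eqP; rewrite -normr_eq0; apply/negPn/negP => B0.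
set K := `|boundary_int P Q x1 x2 y1 y2| in B0.
have K0 : 0 < K by rewrite lt_def B0 normr_ge0.
pose w := x2 - x1; pose h := y2 - y1.
have w0 : 0 <= w by rewrite subr_ge0.
have h0 : 0 <= h by rewrite subr_ge0.
pose W n := w / 2 ^+ n; pose H n := h / 2 ^+ n.
have W0 n : 0 <= W n by rewrite divr_ge0// exprn_ge0.
have H0 n : 0 <= H n by rewrite divr_ge0// exprn_ge0.
have WS n : W n.+1 = W n / 2 by rewrite /W exprSr invfM mulrA.
have HS n : H n.+1 = H n / 2 by rewrite /H exprSr invfM mulrA.
pose good n (p : R * R) :=
  [/\ x1 <= p.1, p.1 + W n <= x2, y1 <= p.2, p.2 + H n <= y2 &
   K / 4 ^+ n <= `|boundary_int P Q p.1 (p.1 + W n) p.2 (p.2 + H n)|].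
have step (np : nat * (R * R)) : exists p' : R * R, good np.1 np.2 ->
    [/\ good np.1.+1 p', np.2.1 <= p'.1 <= np.2.1 + W np.1 / 2
     & np.2.2 <= p'.2 <= np.2.2 + H np.1 / 2].
  case: np => n [x y] /=; have [g|ng] := pselect (good n (x, y)); last by exists (x, y).
  case: (g) => /= g1 g2 g3 g4 g5.
  have cl' : closed_form_on P Q x (x + W n) y (y + H n) by exact: closed_form_onS cl.
  have [x' [y' [hx hy hB]]] := boundary_int_bisect (W0 n) (H0 n) cl' g5.
  exists (x', y') => _; split => //; rewrite /good /= WS HS.
  case/andP: hx => hx1 hx2; case/andP: hy => hy1 hy2.
  split; [lra|lra|lra|lra|].
  by rewrite exprSr invfM mulrA.
have [g Hg] := choice step.
pose u := fix u n := if n is m.+1 then g (m, u m) else (x1, y1).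
have gu n : good n (u n).
  elim: n => [|n ih].
    rewrite /good /= /W /H expr0 !divr1 /w /h.
    have -> : x1 + (x2 - x1) = x2 by ring.
    have -> : y1 + (y2 - y1) = y2 by ring.
    by [].
  by have [] := Hg (n, u n) ih.
have su n := Hg (n, u n) (gu n).
have [x0 Hx0] : exists l, forall n, (u n).1 <= l <= (u n).1 + W n.
  apply: nested_interval => // n; have [_ /andP[a b] _] := su n.
  have := WS n; have := W0 n; rewrite /W /= in b * => hh ->; split => //.
  by move: b; rewrite /=; lra.
have [y0 Hy0] : exists l, forall n, (u n).2 <= l <= (u n).2 + H n.
  apply: nested_interval => // n; have [_ _ /andP[a b]] := su n.
  have := HS n; have := H0 n; rewrite /H /= in b * => hh ->; split => //.
  by move: b; rewrite /=; lra.
have [] : closed_form_at P Q x0 y0.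
  apply: cl.
    by have := Hx0 0%N; rewrite /= /W expr0 divr1 /w; rewrite subrKC.
  by have := Hy0 0%N; rewrite /= /H expr0 divr1 /h; rewrite subrKC.
move=> a [b [c cl0]].
have cl0' : closed_form_at P Q x0 y0 by exists a, b, c.
(* the summand 1 keeps S positive for degenerate rectangles *)
pose S := w + h + 1.
have S0 : 0 < S by rewrite ltr_wpDl// addr_ge0.
pose e := K / 2 / S ^+ 2.
have e0 : 0 < e by rewrite !divr_gt0// exprn_gt0.
have [d d0 Hd] := boundary_int_small cl0' e0.
have [n Hn] : exists n, S / 2 ^+ n < d.
  have z1 : `|1 / 2 : R| < 1 by rewrite ger0_norm; lra.
  have /cvgrPdist_lt/(_ d d0)[n _ /(_ n (leqnn n)) /= Hn] := cvg_geometric S z1.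
  exists n; move: Hn; rewrite sub0r normrN expr_div_n expr1n div1r ger0_norm//.
  by rewrite divr_ge0 ?exprn_ge0// ltW.
have [g1 g2 g3 g4 g5] := gu n.
have ee1 : (u n).1 + W n - (u n).1 = W n by ring.
have ee2 : (u n).2 + H n - (u n).2 = H n by ring.
have P2 : 0 < 2 ^+ n :> R by rewrite exprn_gt0.
have WH : W n + H n <= S / 2 ^+ n.
  by rewrite -mulrDl ler_pM2r ?invr_gt0// /S lerDl.
have := Hd (u n).1 ((u n).1 + W n) (u n).2 ((u n).2 + H n).
rewrite ee1 ee2 => /(_ _ (Hx0 n) (Hy0 n) (le_lt_trans WH Hn)) Hb.
have {}Hb : `|boundary_int P Q (u n).1 ((u n).1 + W n) (u n).2 ((u n).2 + H n)| <=
   e * (W n + H n) ^+ 2 by apply: Hb; exact: closed_form_onS cl.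
have : K / 4 ^+ n <= K / 2 / 4 ^+ n.
  apply: (le_trans g5); apply: (le_trans Hb).
  have -> : K / 2 / 4 ^+ n = e * (S / 2 ^+ n) ^+ 2.
    have -> : (S / 2 ^+ n) ^+ 2 = S ^+ 2 / 4 ^+ n.
      have -> : 4 ^+ n = (2 ^+ n) ^+ 2 :> R by rewrite exprAC; congr (_ ^+ n); ring.
      exact: expr_div_n.
    by rewrite /e; field; rewrite ?expf_neq0 gt_eqF.
  rewrite ler_pM2l// lerXn2r ?nnegrE//; first exact: addr_ge0.
  exact: le_trans (addr_ge0 (W0 n) (H0 n)) WH.
rewrite ler_pM2r ?invr_gt0 ?exprn_gt0//; lra.
Qed.

End Goursat.

(** * Modulus and complex differentiability in real coordinates *)

Section ComplexModulus.
Variable R : realType.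
Implicit Types z w : R[i].

Lemma normE z : `|z| = (normc z)%:C.
Proof. by []. Qed.

Lemma normc_ge0 z : 0 <= normc z.
Proof. by case: z => x y /=; exact: sqrtr_ge0. Qed.

Lemma normc_eq0 z : (normc z == 0) = (z == 0).
Proof.
by apply/eqP/eqP => [/eq0_normc//|->]; exact: normc0.
Qed.

Lemma sqr_normcE z : normc z ^+ 2 = Re z ^+ 2 + Im z ^+ 2.
Proof. by case: z => x y /=; rewrite sqr_sqrtr// addr_ge0// sqr_ge0. Qed.

Lemma Re_le_normc z : `|Re z| <= normc z.
Proof. by have := normc_ge_Re z; rewrite normE lecR. Qed.

Lemma Im_le_normc z : `|Im z| <= normc z.
Proof.
rewrite -ler_sqr ?nnegrE ?normc_ge0// real_normK ?num_real//.
by rewrite sqr_normcE lerDr sqr_ge0.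
Qed.

Lemma normc_real (x : R) : normc x%:C = `|x|.
Proof. by rewrite /= expr0n addr0 sqrtr_sqr. Qed.

Lemma normcX z n : normc (z ^+ n) = normc z ^+ n.
Proof. by elim: n => [|n ih]; rewrite ?expr0 ?normc1// !exprS normcM ih. Qed.

Lemma normc_le_Re_Im (x y : R) : normc (x +i* y) <= `|x| + `|y|.
Proof.
have -> : x +i* y = x%:C + 'i * y%:C by simpc.
rewrite (le_trans (le_normcD _ _))// normcM !normc_real /=.
by rewrite expr0n add0r expr1n sqrtr1 mul1r.
Qed.

Lemma normcB z w : normc (z - w) = normc (w - z).
Proof. by rewrite -opprB normcN. Qed.

Lemma Im_divE w (x y : R) :
  Im (w / (x +i* y)) = (Im w * x - Re w * y) / (x ^+ 2 + y ^+ 2).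
Proof. by case: w => u v /=; ring. Qed.

Lemma Re_divE w (x y : R) :
  Re (w / (x +i* y)) = (Re w * x + Im w * y) / (x ^+ 2 + y ^+ 2).
Proof. by case: w => u v /=; ring. Qed.

End ComplexModulus.

Section ComplexDifferentiability.
Variable R : realType.

(** Complex differentiability with real error bounds and real radii, in which
    form the real and imaginary parts of g can be read off. *)
Definition cdiff (g : R[i] -> R[i]) (z0 : R[i]) := exists c : R[i],
  forall e : R, 0 < e -> exists2 d : R, 0 < d & forall z,
    normc (z - z0) < d -> normc (g z - g z0 - c * (z - z0)) <= e * normc (z - z0).

(** Radii of balls and error bounds in a normed space over R[i] are positive
    elements of R[i]; this turns them into real ones. *)
Lemma pos_complexE (e : R[i]) : 0 < e -> e = (Re e)%:C /\ 0 < Re e.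
Proof. by case: e => x y; rewrite ltcE /= => /andP[/eqP -> ?]. Qed.

Lemma differentiable_cdiff (g : Cplx R -> Cplx R) (z0 : Cplx R) :
  differentiable g z0 -> cdiff g z0.
Proof.
move=> dg; exists ('d g z0 (1 : Cplx R)) => e e0.
have e0' : (0 : R[i]) < e%:C by rewrite ltcR.
have /eqaddoP H := diff_locally dg.
have /nbhs_ballP[d /= d0 Hd] := H _ e0'.
have [dE d0'] := pos_complexE d0.
exists (Re d) => // z zd; have := Hd (z - z0).
rewrite /ball /= sub0r normrN normE dE ltcR => /(_ zd).
have dE' : 'd g z0 (z - z0) = 'd g z0 1 * (z - z0).
  have {1}-> : z - z0 = (z - z0) *: (1 : Cplx R).
    by rewrite /GRing.scale /= mulr1.
  by rewrite linearZ /GRing.scale /= mulrC.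
have -> : (g \o shift z0 - (cst (g z0) + 'd g z0)) (z - z0) =
          g z - g z0 - 'd g z0 1 * (z - z0).
  rewrite -[LHS]/(g (z - z0 + z0) - (g z0 + 'd g z0 (z - z0))) dE' subrK.
  by rewrite opprD addrA.
by rewrite normE -rmorphM /= lecR.
Qed.

(** Im(g dz) = (Im g) dx + (Re g) dy; the shared coefficient is one of the two
    Cauchy-Riemann equations. *)
Lemma cdiff_closed_form (g : R[i] -> R[i]) (x0 y0 : R) :
  cdiff g (x0 +i* y0) ->
  closed_form_at (fun x y => Im (g (x +i* y))) (fun x y => Re (g (x +i* y))) x0 y0.
Proof.
move=> [c H]; exists (Im c), (Re c), (- Im c) => e e0.
(* the modulus is at most |dx| + |dy|, hence half the radius in each direction *)
have [d d0 Hd] := H _ e0; exists (d / 2); first by rewrite divr_gt0.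
move=> x y xd yd; have E : (x +i* y) - (x0 +i* y0) = (x - x0) +i* (y - y0) by [].
have nE : normc ((x +i* y) - (x0 +i* y0)) <= `|x - x0| + `|y - y0|.
  by rewrite E; exact: normc_le_Re_Im.
have := Hd (x +i* y); have -> : normc ((x +i* y) - (x0 +i* y0)) < d.
  by apply: (le_lt_trans nE); rewrite (splitr d) ltrD.
move=> /(_ isT) h; have {}h := le_trans h (ler_wpM2l (ltW e0) nE).
split; apply: le_trans h.
  apply: le_trans (Im_le_normc _); rewrite E.
  case: (g _) (g _) c {H Hd} => u v [u' v'] [c1 c2] /=.
  by rewrite le_eqVlt; apply/orP; left; apply/eqP; congr `| _ |; ring.
apply: le_trans (Re_le_normc _); rewrite E.
case: (g _) (g _) c {H Hd} => u v [u' v'] [c1 c2] /=.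
by rewrite le_eqVlt; apply/orP; left; apply/eqP; congr `| _ |; ring.
Qed.

Lemma cdiff_continuous g z0 : cdiff g z0 ->
  forall e, 0 < e -> exists2 d, 0 < d &
    forall z, normc (z - z0) < d -> normc (g z - g z0) <= e.
Proof.
move=> [c /(_ 1 ltr01)[d d0 H]] e e0.
have c0 : 0 < 1 + normc c by rewrite ltr_wpDr// normc_ge0.
exists (Order.min d (e / (1 + normc c))); first by rewrite lt_min d0 divr_gt0.
move=> z; rewrite lt_min => /andP[/H h zd].
rewrite -[X in normc X](subrK (c * (z - z0))) (le_trans (le_normcD _ _))//.
rewrite normcM (le_trans (lerD h (lexx _)))// -mulrDl mulrC -ler_pdivlMr//.
exact: ltW.
Qed.

End ComplexDifferentiability.

(** * Integrals around a point of holomorphic functions *)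

Section Frame.
Variable R : realType.
Implicit Types P Q : R -> R -> R.

(** The region between two rectangles is cut into four rectangles, to each of
    which Goursat's theorem applies; the form may be singular inside the inner
    one. *)
Lemma boundary_int_frame P Q x1 u1 u2 x2 y1 v1 v2 y2 :
  x1 <= u1 -> u1 <= u2 -> u2 <= x2 -> y1 <= v1 -> v1 <= v2 -> v2 <= y2 ->
  (forall x y, x1 <= x <= x2 -> y1 <= y <= y2 ->
     ~~ ((u1 < x < u2) && (v1 < y < v2)) -> closed_form_at P Q x y) ->
  boundary_int P Q x1 x2 y1 y2 = boundary_int P Q u1 u2 v1 v2.
Proof.
move=> xu uu ux yv vv vy H.
have xu2 := le_trans xu uu; have x12 := le_trans xu2 ux.
have u1x := le_trans uu ux.
have yv2 := le_trans yv vv; have y12 := le_trans yv2 vy.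
have v1y := le_trans vv vy.
have bot : closed_form_on P Q x1 x2 y1 v1.
  move=> x y xx /andP[y1' y2']; apply: H => //.
    by rewrite y1' (le_trans y2').
  by rewrite negb_and [v1 < y]ltNge y2' orbT.
have top : closed_form_on P Q x1 x2 v2 y2.
  move=> x y xx /andP[y1' y2']; apply: H => //.
    by rewrite y2' (le_trans yv2).
  by rewrite negb_and [y < v2]ltNge y1' !andbF orbT.
have left : closed_form_on P Q x1 u1 v1 v2.
  move=> x y /andP[x1' x2'] /andP[y1' y2']; apply: H => //.
  - by rewrite x1' (le_trans x2').
  - by rewrite (le_trans yv)// (le_trans y2').
  - by rewrite negb_and [u1 < x]ltNge x2'.
have right : closed_form_on P Q u2 x2 v1 v2.
  move=> x y /andP[x1' x2'] /andP[y1' y2']; apply: H => //.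
  - by rewrite x2' (le_trans xu2).
  - by rewrite (le_trans yv)// (le_trans y2').
  - by rewrite negb_and [x < u2]ltNge x1' !andbF.
have cQ x : x1 <= x <= x2 -> ~~ (u1 < x < u2) -> continuous_on y1 y2 (Q x).
  move=> xx xu' y yy; have [|_ //] := @closed_form_continuous _ P Q x y.
  by apply: H => //; rewrite negb_and xu'.
have cP y : y1 <= y <= y2 -> ~~ (v1 < y < v2) -> continuous_on x1 x2 (P ^~ y).
  move=> xx xu' x yy; have [|//] := @closed_form_continuous _ P Q x y.
  by apply: H => //; rewrite negb_and xu' orbT.
have B := goursat x12 yv bot; have T := goursat x12 vy top.
have L := goursat xu vv left; have D := goursat ux vv right.
have sQ x : x1 <= x <= x2 -> ~~ (u1 < x < u2) -> itvint y1 y2 (Q x) =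
    itvint y1 v1 (Q x) + (itvint v1 v2 (Q x) + itvint v2 y2 (Q x)).
  move=> xx xu'; have c := cQ _ xx xu'.
  rewrite (itvint_split yv v1y c) (itvint_split vv vy)//.
  exact: continuous_onS c.
have sP y : y1 <= y <= y2 -> ~~ (v1 < y < v2) -> itvint x1 x2 (P ^~ y) =
    itvint x1 u1 (P ^~ y) + (itvint u1 u2 (P ^~ y) + itvint u2 x2 (P ^~ y)).
  move=> xx xu'; have c := cP _ xx xu'.
  rewrite (itvint_split xu u1x c) (itvint_split uu ux)//.
  exact: continuous_onS c.
have e1 := sQ x1; rewrite lexx x12 [u1 < x1]ltNge xu in e1.
have e2 := sQ x2; rewrite lexx x12 [x2 < u2]ltNge ux andbF in e2.
have e3 := sP v1; rewrite yv v1y ltxx in e3.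
have e4 := sP v2; rewrite yv2 vy ltxx andbF in e4.
move: B T L D; rewrite /boundary_int (e1 isT isT) (e2 isT isT).
rewrite (e3 isT isT) (e4 isT isT); clear; lra.
Qed.

End Frame.

Section SquareMeanValue.
Variable R : realType.
Implicit Types (h : R[i] -> R[i]) (a : R[i]).

(** The coefficients of dx and dy in the imaginary part of h(z) dz/(z-a). It is
    the imaginary part that sees the winding around a: for h = 1 the integral is
    2 pi i. *)
Definition cauchy_dx h a (x y : R) := Im (h (x +i* y) / (x +i* y - a)).
Definition cauchy_dy h a (x y : R) := Re (h (x +i* y) / (x +i* y - a)).

Lemma cauchy_dx_le h a (x y d : R) : 0 < d -> d <= normc (x +i* y - a) ->
  d * `|cauchy_dx h a x y| <= normc (h (x +i* y)).
Proof.
move=> d0 dn; have n0 := lt_le_trans d0 dn.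
have := Im_le_normc (h (x +i* y) / (x +i* y - a)).
rewrite -/(cauchy_dx h a x y) normcM normcV ler_pdivlMr// => /(le_trans _); apply.
by rewrite mulrC ler_wpM2l.
Qed.

Lemma cauchy_dy_le h a (x y d : R) : 0 < d -> d <= normc (x +i* y - a) ->
  d * `|cauchy_dy h a x y| <= normc (h (x +i* y)).
Proof.
move=> d0 dn; have n0 := lt_le_trans d0 dn.
have := Re_le_normc (h (x +i* y) / (x +i* y - a)).
rewrite -/(cauchy_dy h a x y) normcM normcV ler_pdivlMr// => /(le_trans _); apply.
by rewrite mulrC ler_wpM2l.
Qed.

(** On the horizontal sides of a square of half-side d around a, replacing h by
    its value u at a costs at most eta/d on each side, while the constant u
    contributes 2ud/((x-a1)^2+d^2) >= u/d. *)
Lemma cauchy_dx_diff h (a1 a2 x d u eta : R) : 0 < d -> `|x - a1| <= d ->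
  h (a1 +i* a2) = u%:C -> 0 <= u ->
  normc (h (x +i* (a2 - d)) - h (a1 +i* a2)) <= eta ->
  normc (h (x +i* (a2 + d)) - h (a1 +i* a2)) <= eta ->
  (u - 2 * eta) / d <= cauchy_dx h (a1 +i* a2) x (a2 - d) - cauchy_dx h (a1 +i* a2) x (a2 + d).
Proof.
move=> d0 xd ha u0 e1 e2; set a := a1 +i* a2.
pose k z := h z - h a.
have dn s : `|s| = d -> d <= normc (x +i* (a2 + s) - a).
  move=> <-; have := Im_le_normc (x +i* (a2 + s) - a).
  by rewrite /= addrAC subrr add0r.
have sp s : cauchy_dx h a x (a2 + s) =
    - (u * s) / ((x - a1) ^+ 2 + s ^+ 2) + cauchy_dx k a x (a2 + s).
  rewrite /cauchy_dx /k (_ : x +i* (a2 + s) - a = (x - a1) +i* s); last first.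
    by congr (_ +i* _); rewrite /= addrAC subrr add0r.
  by rewrite !Im_divE ha; case: (h _) => p q /=; ring.
have b1 : `|cauchy_dx k a x (a2 - d)| <= eta / d.
  rewrite ler_pdivlMr// mulrC (le_trans (cauchy_dx_le _ _ (dn (- d) _)))//.
  by rewrite normrN gtr0_norm.
have b2 : `|cauchy_dx k a x (a2 + d)| <= eta / d.
  rewrite ler_pdivlMr// mulrC (le_trans (cauchy_dx_le _ _ (dn d _)))//.
  by rewrite gtr0_norm.
rewrite !sp sqrrN mulrN opprK.
set D := (x - a1) ^+ 2 + d ^+ 2.
have D0 : 0 < D by rewrite ltr_wpDl ?sqr_ge0// exprn_gt0.
have Dd : D <= 2 * d ^+ 2.
  by rewrite mulr_natl mulr2n lerD2r -real_normK ?num_real// lerXn2r ?nnegrE// ltW.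
have m : u / d <= 2 * (u * d / D).
  rewrite mulrA ler_pdivlMr// mulrAC ler_pdivrMr//.
  rewrite (le_trans (ler_wpM2l u0 Dd))//.
  by rewrite le_eqVlt; apply/orP; left; apply/eqP; ring.
move: b1 b2; rewrite !ler_norml => /andP[b1 _] /andP[_ b2].
have -> : (u - 2 * eta) / d = u / d - 2 * (eta / d) by ring.
by rewrite mulNr; lra.
Qed.

Lemma cauchy_dy_diff h (a1 a2 y d u eta : R) : 0 < d -> `|y - a2| <= d ->
  h (a1 +i* a2) = u%:C -> 0 <= u ->
  normc (h ((a1 - d) +i* y) - h (a1 +i* a2)) <= eta ->
  normc (h ((a1 + d) +i* y) - h (a1 +i* a2)) <= eta ->
  (u - 2 * eta) / d <= cauchy_dy h (a1 +i* a2) (a1 + d) y - cauchy_dy h (a1 +i* a2) (a1 - d) y.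
Proof.
move=> d0 xd ha u0 e1 e2; set a := a1 +i* a2.
pose k z := h z - h a.
have dn s : `|s| = d -> d <= normc ((a1 + s) +i* y - a).
  move=> <-; have := Re_le_normc ((a1 + s) +i* y - a).
  by rewrite /= addrAC subrr add0r.
have sp s : cauchy_dy h a (a1 + s) y =
    (u * s) / (s ^+ 2 + (y - a2) ^+ 2) + cauchy_dy k a (a1 + s) y.
  rewrite /cauchy_dy /k (_ : (a1 + s) +i* y - a = s +i* (y - a2)); last first.
    by congr (_ +i* _); rewrite /= addrAC subrr add0r.
  by rewrite !Re_divE ha; case: (h _) => p q /=; ring.
have b1 : `|cauchy_dy k a (a1 - d) y| <= eta / d.
  rewrite ler_pdivlMr// mulrC (le_trans (cauchy_dy_le _ _ (dn (- d) _)))//.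
  by rewrite normrN gtr0_norm.
have b2 : `|cauchy_dy k a (a1 + d) y| <= eta / d.
  rewrite ler_pdivlMr// mulrC (le_trans (cauchy_dy_le _ _ (dn d _)))//.
  by rewrite gtr0_norm.
rewrite !sp sqrrN mulrN.
set D := d ^+ 2 + (y - a2) ^+ 2.
have D0 : 0 < D by rewrite ltr_pwDl ?sqr_ge0// exprn_gt0.
have Dd : D <= 2 * d ^+ 2.
  by rewrite mulr_natl mulr2n lerD2l -real_normK ?num_real// lerXn2r ?nnegrE// ltW.
have m : u / d <= 2 * (u * d / D).
  rewrite mulrA ler_pdivlMr// mulrAC ler_pdivrMr//.
  rewrite (le_trans (ler_wpM2l u0 Dd))//.
  by rewrite le_eqVlt; apply/orP; left; apply/eqP; ring.
move: b1 b2; rewrite !ler_norml => /andP[_ b1] /andP[b2 _].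
have -> : (u - 2 * eta) / d = u / d - 2 * (eta / d) by ring.
by rewrite mulNr; lra.
Qed.

(** A weak form of Cauchy's formula, with 4 in place of 2 pi: the square can be
    shrunk to a without changing the integral, and there [cauchy_dx_diff] and
    [cauchy_dy_diff] apply with eta arbitrarily small. *)
Lemma boundary_cauchy_ge h (a1 a2 u x1 x2 y1 y2 : R) :
  x1 < a1 < x2 -> y1 < a2 < y2 -> h (a1 +i* a2) = u%:C -> 0 <= u ->
  (forall e, 0 < e -> exists2 d, 0 < d &
     forall z, normc (z - (a1 +i* a2)) < d -> normc (h z - h (a1 +i* a2)) <= e) ->
  (forall x y, x1 <= x <= x2 -> y1 <= y <= y2 -> (x, y) != (a1, a2) ->
     closed_form_at (cauchy_dx h (a1 +i* a2)) (cauchy_dy h (a1 +i* a2)) x y) ->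
  4 * u <= boundary_int (cauchy_dx h (a1 +i* a2)) (cauchy_dy h (a1 +i* a2)) x1 x2 y1 y2.
Proof.
move=> /andP[xa ax] /andP[ya ay] ha u0 ch cl; set a := a1 +i* a2 in ch cl *.
apply/ler_addgt0Pr => e e0; rewrite -lerBlDr.
have [|d' d'0 Hd'] := ch (e / 8); first by rewrite divr_gt0.
(* a third: two coordinates of size d stay strictly within radius d' *)
pose d := Num.min (d' / 3) (Num.min (Num.min (a1 - x1) (x2 - a1))
                                     (Num.min (a2 - y1) (y2 - a2))).
have d0 : 0 < d by rewrite !lt_min !subr_gt0 xa ax ya ay divr_gt0.
have : d <= d by [].
rewrite {2}/d !le_min -!andbA => /and5P[dd d1 d2 d3 d4]; clearbody d.
have near x y : `|x - a1| <= d -> `|y - a2| <= d ->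
    normc (h (x +i* y) - h a) <= e / 8.
  move=> hx hy; apply: Hd'.
  apply: (@le_lt_trans _ _ (`|x - a1| + `|y - a2|)); first exact: normc_le_Re_Im.
  by apply: (le_lt_trans (lerD hx hy)); move: dd d'0; lra.
have dpos : `|a1 + d - a1| <= d /\ `|a1 - d - a1| <= d.
  by split; rewrite addrAC subrr add0r ?normrN gtr0_norm.
have dpos2 : `|a2 + d - a2| <= d /\ `|a2 - d - a2| <= d.
  by split; rewrite addrAC subrr add0r ?normrN gtr0_norm.
rewrite (@boundary_int_frame _ _ _ x1 (a1 - d) (a1 + d) x2 y1 (a2 - d) (a2 + d) y2);
  [|clear -d0 d1 d2 d3 d4; lra..|]; last first.
  move=> x y xx yy nin; apply: cl => //; apply: contra nin => /eqP[-> ->].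
  by rewrite !ltrBlDr !ltrDl d0.
have clin x y : a1 - d <= x <= a1 + d -> a2 - d <= y <= a2 + d ->
    (x, y) != (a1, a2) -> closed_form_at (cauchy_dx h a) (cauchy_dy h a) x y.
  move=> /andP[h1 h2] /andP[h3 h4]; apply: cl; apply/andP.
    by clear -h1 h2 d1 d2; split; lra.
  by clear -h3 h4 d3 d4; split; lra.
have ne1 s : s != 0 -> forall x, (x, a2 + s) != (a1, a2).
  by move=> s0 x; rewrite xpair_eqE -{2}[a2]addr0 (inj_eq (addrI _)) negb_and s0 orbT.
have ne2 s : s != 0 -> forall y, (a1 + s, y) != (a1, a2).
  by move=> s0 x; rewrite xpair_eqE -{2}[a1]addr0 (inj_eq (addrI _)) negb_and s0.
have dn0 : d != 0 by rewrite gt_eqF.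
have dn0' : - d != 0 by rewrite oppr_eq0 gt_eqF.
have cP s : s != 0 -> a2 - d <= a2 + s <= a2 + d ->
    continuous_on (a1 - d) (a1 + d) (cauchy_dx h a ^~ (a2 + s)).
  move=> s0 ss x xx; have [|//] := @closed_form_continuous _ (cauchy_dx h a) (cauchy_dy h a) x (a2 + s).
  by apply: clin => //; exact: ne1.
have cQ s : s != 0 -> a1 - d <= a1 + s <= a1 + d ->
    continuous_on (a2 - d) (a2 + d) (cauchy_dy h a (a1 + s)).
  move=> s0 ss y yy; have [|_ //] := @closed_form_continuous _ (cauchy_dx h a) (cauchy_dy h a) (a1 + s) y.
  by apply: clin => //; exact: ne2.
have r1 : a1 - d <= a1 + d by lra.
have r2 : a2 - d <= a2 + d by lra.
have cPm := cP (- d) dn0' (introT andP (conj (lexx _) r2)).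
have cPp := cP d dn0 (introT andP (conj r2 (lexx _))).
have cQm := cQ (- d) dn0' (introT andP (conj (lexx _) r1)).
have cQp := cQ d dn0 (introT andP (conj r1 (lexx _))).
have -> : boundary_int (cauchy_dx h a) (cauchy_dy h a) (a1 - d) (a1 + d) (a2 - d) (a2 + d) =
  itvint (a1 - d) (a1 + d) (fun x => cauchy_dx h a x (a2 - d) - cauchy_dx h a x (a2 + d)) +
  itvint (a2 - d) (a2 + d) (fun y => cauchy_dy h a (a1 + d) y - cauchy_dy h a (a1 - d) y).
  by rewrite -!itvintB// /boundary_int; ring.
have cB (k l : R) f g : continuous_on k l f -> continuous_on k l g ->
    continuous_on k l (fun x => f x - g x).
  by move=> cf cg x xx; apply: cvgB; [exact: cf|exact: cg].
have lo : 4 * u - e = (u - 2 * (e / 8)) / d * (a1 + d - (a1 - d)) +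
   (u - 2 * (e / 8)) / d * (a2 + d - (a2 - d)) by field.
rewrite lo; apply: lerD; rewrite -itvint_cst//; apply: le_itvint.
- exact: continuous_on_cst.
- exact: cB.
- move=> x /andP[x1' x2']; have xx : `|x - a1| <= d by rewrite ler_norml; lra.
  by apply: cauchy_dx_diff => //; apply: near; case: dpos2.
- exact: continuous_on_cst.
- exact: cB.
- move=> y /andP[y1' y2']; have yy : `|y - a2| <= d by rewrite ler_norml; lra.
  by apply: cauchy_dy_diff => //; apply: near; case: dpos.
Qed.

End SquareMeanValue.

(** * The mean value inequality on squares *)

Section IntegralMonotone.
Local Open Scope ereal_scope.
Context d (T : measurableType d) (R : realType).
Variable mu : {measure set T -> \bar R}.

Import HBNNSimple.

(** Integrals of nonnegative functions are suprema over the simple functions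
    below them, so comparing two of them takes no measurability. *)
Lemma le_integral_ge0 (D : set T) (f g : T -> \bar R) :
  (forall x, D x -> 0 <= f x) -> (forall x, D x -> f x <= g x) ->
  \int[mu]_(x in D) f x <= \int[mu]_(x in D) g x.
Proof.
move=> f0 fg; have g0 x : D x -> 0 <= g x.
  by move=> Dx; rewrite (le_trans (f0 x Dx))// fg.
rewrite !ge0_integralE//; apply: ereal_sup_le => _ [h /= hf <-].
exists h => //= x.
apply: (le_trans (hf x)); rewrite /patch; case: ifPn => //.
by rewrite inE; exact: fg.
Qed.

Lemma le_integral_subset (A B : set T) (f g : T -> \bar R) : A `<=` B ->
  (forall x, A x -> 0 <= f x) -> (forall x, B x -> 0 <= g x) ->
  (forall x, A x -> f x <= g x) ->
  \int[mu]_(x in A) f x <= \int[mu]_(x in B) g x.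
Proof.
move=> AB f0 g0 fg; rewrite integral_mkcond [leRHS]integral_mkcond.
apply: le_integral_ge0 => x _; rewrite /patch.
  by case: ifPn => //; rewrite inE => Ax; exact: f0.
case: ifPn; rewrite ?inE => Ax.
  by rewrite mem_set ?fg//; exact: AB.
by case: ifPn => //; rewrite inE => Bx; exact: g0.
Qed.

End IntegralMonotone.

Section AreaMeanValue.
Variable R : realType.
Notation leb := (@lebesgue_measure R).

Lemma itvint_lt (a b d M : R) (f : R -> R) (G : R -> \bar R) :
  0 < d -> continuous_on a b f -> (forall x, 0 <= G x)%E ->
  (forall x, a <= x <= b -> ((d * `|f x|)%:E <= G x)%E) ->
  (\int[leb]_x G x < M%:E)%E -> d * `|itvint a b f| < M.
Proof.
move=> d0 cf G0 fG GM; rewrite -lte_fin; apply: le_lt_trans GM.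
have If := continuous_on_integrable cf.
have Idf : leb.-integrable `[a, b] (EFin \o (fun x => d * f x)).
  rewrite (_ : _ \o _ = (fun x => d%:E * (EFin \o f) x)%E); last exact/funext.
  exact: integrableZl.
rewrite -{1}(gtr0_norm d0) -normrM /itvint -RintegralZl// EFin_normr_Rintegral//.
apply: (le_trans (le_abse_integral _ _ _)) => //; first exact: measurable_int Idf.
apply: le_integral_subset => // x; rewrite /= in_itv/= => xab.
by rewrite normrM (gtr0_norm d0); exact: fG.
Qed.

Lemma exists_lt_of_integral_lt (a b M : R) (A : R -> \bar R) : a < b ->
  (forall x, 0 <= A x)%E -> (\int[leb]_x A x < (M * (b - a))%:E)%E ->
  exists2 x, a <= x <= b & (A x < M%:E)%E.
Proof.
move=> ab A0 AM; apply: contrapT => H.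
have M0 : 0 <= M.
  have : (0 <= \int[leb]_x A x)%E by exact: integral_ge0.
  move=> /le_lt_trans /(_ AM).
  by rewrite lte_fin pmulr_lgt0 ?subr_gt0// => /ltW.
move: AM; apply/negP; rewrite -leNgt.
have -> : (M * (b - a))%:E = (\int[leb]_(x in `[a, b]) (cst M%:E) x)%E.
  by rewrite integral_cst//= lebesgue_measure_itv/= lte_fin ab EFinM.
apply: le_integral_subset => // x; rewrite /= in_itv/= => xab.
by rewrite leNgt; apply/negP => AxM; apply: H; exists x.
Qed.

Lemma phase_normalisation (w : R[i]) (k : R) : 0 <= k ->
  exists2 c : R[i], normc c = k & c * w = (k * normc w)%:C.
Proof.
move=> k0; have [->|w0] := eqVneq w 0.
  exists k%:C; first by rewrite normc_real ger0_norm.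
  by have /eqP -> : normc (0 : R[i]) == 0; rewrite ?normc_eq0// !mulr0.
exists (k%:C * ((normc w)%:C / w)).
  rewrite !normcM normcV !normc_real !ger0_norm ?normc_ge0// mulfV ?mulr1//.
  by rewrite normc_eq0.
by rewrite -mulrA divfK// rmorphM.
Qed.

(** Cauchy's formula is applied to h = c f^2, with |c| = k and the phase of c
    chosen so that h(a) = k |f(a)|^2 is real. The four sides of the rectangle
    are placed at distance between r/2 and r from a, each where the integral
    of G along it is at most its average. *)
Lemma square_mean_value (f : Cplx R -> Cplx R) (a1 a2 r k : R)
    (G : R * R -> \bar R) :
  0 < r -> 0 <= k ->
  (forall x y, `|x - a1| <= r -> `|y - a2| <= r -> differentiable f (x +i* y : Cplx R)) ->
  measurable_fun setT G -> (forall w, 0 <= G w)%E ->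
  (forall x y, `|x - a1| <= r -> `|y - a2| <= r ->
    ((k * normc (f (x +i* y)) ^+ 2)%:E <= G (x, y))%E) ->
  ((k * normc (f (a1 +i* a2)) ^+ 2 * (r ^+ 2 / 4))%:E <=
    \int[leb \x leb]_w G w)%E.
Proof.
move=> r0 k0 df mG G0 fG; set a := a1 +i* a2.
have [c nc cf] := phase_normalisation (f a ^+ 2) k0.
rewrite normcX in cf; set u := k * normc (f a) ^+ 2 in cf *.
have u0 : 0 <= u by rewrite mulr_ge0// sqr_ge0.
pose h (z : Cplx R) : Cplx R := (c : Cplx R) * (f z * f z).
have ha : h a = u%:C by rewrite -cf expr2.
have nh z : normc (h z) = k * normc (f z) ^+ 2 by rewrite !normcM nc expr2.
have dh (z : Cplx R) : differentiable f z -> differentiable h z.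
  move=> dfz; apply: differentiableM; first exact: differentiable_cst.
  exact: differentiableM.
have da : differentiable f (a : Cplx R) by apply: df; rewrite subrr normr0 ltW.
have ch := cdiff_continuous (differentiable_cdiff (dh _ da)).
have cl x y : `|x - a1| <= r -> `|y - a2| <= r -> (x, y) != (a1, a2) ->
    closed_form_at (cauchy_dx h a) (cauchy_dy h a) x y.
  move=> hx hy ne; apply: (@cdiff_closed_form _ (fun z => h z / (z - a))).
  apply: (@differentiable_cdiff _ (fun z : Cplx R => h z / (z - a))).
  apply: differentiableM; first exact/dh/df.
  have da' : differentiable (fun z : Cplx R => z - (a : Cplx R)) (x +i* y : Cplx R).
    apply: (@differentiableB _ (Cplx R) (Cplx R) idfun (cst (a : Cplx R))).
      by apply/derivable1_diffP; exact: derivable_id.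
    exact: differentiable_cst.
  apply: (differentiableV da').
  by rewrite subr_eq0; apply: contra ne => /eqP[-> ->].
rewrite leNgt; apply/negP => IM.
have G10 x : (0 <= \int[leb]_y G (x, y))%E by exact: integral_ge0.
have G20 y : (0 <= \int[leb]_x G (x, y))%E by exact: integral_ge0.
have rr s : (u * (r / 2) * (s + r / 2 - s)) = u * (r ^+ 2 / 4) by field.
have E1 : (\int[leb \x leb]_w G w = \int[leb]_x (\int[leb]_y G (x, y)))%E.
  exact: fubini_tonelli1.
have E2 : (\int[leb \x leb]_w G w = \int[leb]_y (\int[leb]_x G (x, y)))%E.
  exact: fubini_tonelli2.
have IA s : (\int[leb]_x (\int[leb]_y G (x, y)) < (u * (r / 2) * (s + r / 2 - s))%:E)%E.
  by rewrite rr -E1.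
have IB s : (\int[leb]_y (\int[leb]_x G (x, y)) < (u * (r / 2) * (s + r / 2 - s))%:E)%E.
  by rewrite rr -E2.
have sr s : s < s + r / 2 by rewrite ltrDl divr_gt0.
(* the sides lie in intervals of length r/2 adjacent to the square's boundary *)
have [x1 /andP[x1a x1b] X1] := exists_lt_of_integral_lt (sr (a1 - r)) G10 (IA _).
have [x2 /andP[x2a x2b] X2] := exists_lt_of_integral_lt (sr (a1 + r / 2)) G10 (IA _).
have [y1 /andP[y1a y1b] Y1] := exists_lt_of_integral_lt (sr (a2 - r)) G20 (IB _).
have [y2 /andP[y2a y2b] Y2] := exists_lt_of_integral_lt (sr (a2 + r / 2)) G20 (IB _).
have bx x : x1 <= x <= x2 -> `|x - a1| <= r.
  by move=> /andP[k1 k2]; rewrite ler_norml; clear -k1 k2 x1a x2b; lra.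
have by' y : y1 <= y <= y2 -> `|y - a2| <= r.
  by move=> /andP[k1 k2]; rewrite ler_norml; clear -k1 k2 y1a y2b; lra.
have x12 : x1 <= x2 by clear -r0 x1b x2a; lra.
have y12 : y1 <= y2 by clear -r0 y1b y2a; lra.
have x1r : x1 <= x1 <= x2 by rewrite lexx.
have x2r : x1 <= x2 <= x2 by rewrite lexx andbT.
have y1r : y1 <= y1 <= y2 by rewrite lexx.
have y2r : y1 <= y2 <= y2 by rewrite lexx andbT.
have farx x y : r / 2 <= `|x - a1| -> r / 2 <= normc (x +i* y - a).
  by move=> /le_trans; apply; exact: (Re_le_normc (x +i* y - a)).
have fary x y : r / 2 <= `|y - a2| -> r / 2 <= normc (x +i* y - a).
  by move=> /le_trans; apply; exact: (Im_le_normc (x +i* y - a)).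
have fx1 : r / 2 <= `|x1 - a1|
  by rewrite ler_normr; apply/orP; right; clear -r0 x1a x1b; lra.
have fx2 : r / 2 <= `|x2 - a1|
  by rewrite ler_normr; apply/orP; left; clear -r0 x2a x2b; lra.
have fy1 : r / 2 <= `|y1 - a2|
  by rewrite ler_normr; apply/orP; right; clear -r0 y1a y1b; lra.
have fy2 : r / 2 <= `|y2 - a2|
  by rewrite ler_normr; apply/orP; left; clear -r0 y2a y2b; lra.
have r20 : 0 < r / 2 by rewrite divr_gt0.
have nea (s t : R) : r / 2 <= `|s - t| -> s != t.
  by apply: contraTneq => ->; rewrite subrr normr0 -ltNge.
have horizontal y : y1 <= y <= y2 -> r / 2 <= `|y - a2| ->
    (\int[leb]_x G (x, y) < (u * (r / 2))%:E)%E ->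
    r / 2 * `|itvint x1 x2 (cauchy_dx h a ^~ y)| < u * (r / 2).
  move=> yy fy; apply: itvint_lt => //.
    move=> x xx; have [|//] := @closed_form_continuous _ (cauchy_dx h a) (cauchy_dy h a) x y.
    by apply: cl; [exact: bx|exact: by'|rewrite xpair_eqE negb_and (nea _ _ fy) orbT].
  move=> x xx; apply: le_trans (fG _ _ (bx _ xx) (by' _ yy)); rewrite lee_fin -nh.
  by apply: cauchy_dx_le => //; exact: fary.
have vertical x : x1 <= x <= x2 -> r / 2 <= `|x - a1| ->
    (\int[leb]_y G (x, y) < (u * (r / 2))%:E)%E ->
    r / 2 * `|itvint y1 y2 (cauchy_dy h a x)| < u * (r / 2).
  move=> xx fx; apply: itvint_lt => //.
    move=> y yy; have [|_ //] := @closed_form_continuous _ (cauchy_dx h a) (cauchy_dy h a) x y.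
    by apply: cl; [exact: bx|exact: by'|rewrite xpair_eqE negb_and (nea _ _ fx)].
  move=> y yy; apply: le_trans (fG _ _ (bx _ xx) (by' _ yy)); rewrite lee_fin -nh.
  by apply: cauchy_dy_le => //; exact: farx.
have := @boundary_cauchy_ge _ h a1 a2 u x1 x2 y1 y2.
have -> : x1 < a1 < x2 by apply/andP; clear -r0 x1b x2a; split; lra.
have -> : y1 < a2 < y2 by apply/andP; clear -r0 y1b y2a; split; lra.
move=> /(_ isT isT ha u0 ch).
have cl' x y : x1 <= x <= x2 -> y1 <= y <= y2 -> (x, y) != (a1, a2) ->
    closed_form_at (cauchy_dx h a) (cauchy_dy h a) x y.
  by move=> xx yy; apply: cl; [exact: bx|exact: by'].
move=> /(_ cl') up.
have h1 := horizontal _ y1r fy1 Y1; have h2 := horizontal _ y2r fy2 Y2.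
have v1 := vertical _ x1r fx1 X1; have v2 := vertical _ x2r fx2 X2.
have bnd (t : R) : r / 2 * `|t| < u * (r / 2) -> - u < t < u.
  by rewrite [u * _]mulrC ltr_pM2l// ltr_norml.
case/andP: (bnd _ h1) (bnd _ h2) (bnd _ v1) (bnd _ v2) => _ k1 /andP[k2 _] /andP[k3 _] /andP[_ k4].
by move: up; rewrite /boundary_int; clear -k1 k2 k3 k4; lra.
Qed.
End AreaMeanValue.

(** * The maximum principle for rational functions on an annulus *)

Section ComplexPlane.
Variable R : realType.

Lemma continuous_normc : continuous (fun z : Cplx R => normc z : R^o).
Proof.
move=> z; apply/(@cvgrPdist_lt _ R^o _ (nbhs z) _) => e e0.
have e0' : (0 : R[i]) < e%:C by rewrite ltcR.
apply/nbhs_ballP; exists e%:C => //= w; rewrite /ball /= normE ltcR.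
have tri (a b : R[i]) : normc a - normc b <= normc (a - b).
  by rewrite lerBlDr -{1}[a](subrK b) le_normcD.
by apply: le_lt_trans; rewrite ler_norml lerNl opprB tri normcB tri.
Qed.

Lemma continuous_complex : continuous (fun w : R * R => w.1 +i* w.2 : Cplx R).
Proof.
move=> w; apply/cvgrPdist_lt => e e0.
have [-> e0'] := pos_complexE e0.
have e2 : 0 < Re e / 2 by rewrite divr_gt0.
exists (ball w.1 (Re e / 2), ball w.2 (Re e / 2)); first by split; exact: nbhsx_ballx.
move=> v [/= h1 h2]; rewrite normE ltcR.
apply: le_lt_trans (normc_le_Re_Im _ _) _.
by rewrite (splitr (Re e)) ltrD.
Qed.

Lemma differentiable_horner (A : {poly R[i]}) (z : Cplx R) :
  differentiable (horner A : Cplx R -> Cplx R) z.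
Proof.
elim/poly_ind: A => [|A c ih].
  rewrite (_ : horner _ = cst 0); first exact: differentiable_cst.
  by apply/funext => w; rewrite horner0.
rewrite (_ : horner _ = (horner A : Cplx R -> Cplx R) * id + cst c).
  apply: differentiableD; last exact: differentiable_cst.
  exact: differentiableM.
by apply/funext => w; rewrite hornerMXaddC.
Qed.

Lemma differentiable_ratio (A B : {poly R[i]}) (z : Cplx R) : B.[z] != 0 ->
  differentiable (fun z : Cplx R => (A.[z] / B.[z]) : Cplx R) z.
Proof.
move=> B0; apply: differentiableM; first exact: differentiable_horner.
by apply: differentiableV => //; exact: differentiable_horner.
Qed.

(** The parallelogram-type identity for the four points t, -t, it, -it: all
    mixed terms cancel since h, h^2 and h conj(h)^2 sum to zero over them. *)
Lemma sum4_sqr_normc (a0 a1 a2 : R[i]) (t : R) :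
  normc (a0 + a1 * t%:C + a2 * t%:C ^+ 2) ^+ 2 +
  normc (a0 + a1 * (- t%:C) + a2 * (- t%:C) ^+ 2) ^+ 2 +
  normc (a0 + a1 * ('i * t%:C) + a2 * ('i * t%:C) ^+ 2) ^+ 2 +
  normc (a0 + a1 * (- ('i * t%:C)) + a2 * (- ('i * t%:C)) ^+ 2) ^+ 2 =
  4 * (normc a0 ^+ 2 + normc a1 ^+ 2 * t ^+ 2 + normc a2 ^+ 2 * t ^+ 4).
Proof.
rewrite !sqr_normcE.
by case: a0 a1 a2 => [x0 y0] [x1 y1] [x2 y2] /=; ring.
Qed.

Lemma sqr_normcD_ge (u v : R[i]) :
  normc u ^+ 2 - 2 * normc u * normc v <= normc (u + v) ^+ 2.
Proof.
have h : normc u <= normc (u + v) + normc v.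
  by rewrite -{1}(addrK v u) -(normcN v) le_normcD.
move: h (normc_ge0 u) (normc_ge0 v) (normc_ge0 (u + v)).
move: (normc u) (normc v) (normc (u + v)) => p q s h p0 q0 s0.
have [pq|qp] := leP p q; nra.
Qed.

End ComplexPlane.

Section MaximumModulus.
Variable R : realType.
Implicit Types (A B : {poly R[i]}) (z : R[i]).

(** The first-order Taylor expansion of A/B at z0, whose remainder is again a
    quotient by B, so that it can be iterated. *)
Lemma ratio_linearE A B z0 : B.[z0] != 0 ->
  exists A1 : {poly R[i]}, forall z, B.[z] != 0 ->
    A.[z] / B.[z] = A.[z0] / B.[z0] + (z - z0) * (A1.[z] / B.[z]).
Proof.
move=> B0; have : root (A - (A.[z0] / B.[z0])%:P * B) z0.
  by rewrite rootE !hornerE divfK// subrr.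
move=> /factor_theorem[A1 E]; exists A1 => z Bz.
have {}E : A.[z] = A.[z0] / B.[z0] * B.[z] + A1.[z] * (z - z0).
  have : (A - (A.[z0] / B.[z0])%:P * B).[z] = (A1 * ('X - z0%:P)).[z] by rewrite E.
  by rewrite !hornerE => /eqP; rewrite subr_eq addrC => /eqP.
by rewrite E; field; rewrite Bz B0.
Qed.

(** By [sum4_sqr_normc] the mean of |A/B|^2 over z0 + h, h = t, -t, it, -it, is
    at least its value at z0 up to o(t^2), and that of eps |z|^2 exceeds its
    value by exactly eps t^2. *)
Lemma ratio_no_local_max A B z0 (eps d0 : R) : B.[z0] != 0 -> 0 < eps -> 0 < d0 ->
  exists2 z, normc (z - z0) < d0 & B.[z] != 0 /\
    normc (A.[z0] / B.[z0]) ^+ 2 + eps * normc z0 ^+ 2 <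
    normc (A.[z] / B.[z]) ^+ 2 + eps * normc z ^+ 2.
Proof.
move=> B0 eps0 d00.
have [A1 E1] := ratio_linearE A B0; have [A2 E2] := ratio_linearE A1 B0.
set a0 := A.[z0] / B.[z0] in E1 *; set a1 := A1.[z0] / B.[z0] in E2.
pose a2 := A2.[z0] / B.[z0].
pose U := normc a0 + normc a1 + normc a2.
have U0 : 0 <= U by rewrite !addr_ge0 ?normc_ge0.
have [eta etaE] : exists eta, eta = eps / (4 * (U + 1)) by eexists.
have eta0 : 0 < eta by rewrite etaE divr_gt0// mulr_gt0// ltr_wpDl.
have [d1 d10 H1] := cdiff_continuous (differentiable_cdiff (differentiable_ratio A2 B0)) eta0.
have nB0 : 0 < normc B.[z0] / 2 by rewrite divr_gt0// lt_def normc_eq0 B0 normc_ge0.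
have [d2 d20 H2] := cdiff_continuous (differentiable_cdiff (differentiable_horner B z0)) nB0.
pose t := Num.min (1 : R) (Num.min d0 (Num.min d1 d2)) / 2.
have t0 : 0 < t by rewrite divr_gt0// !lt_min ltr01 d00 d10.
have : t * 2 <= Num.min 1 (Num.min d0 (Num.min d1 d2)) by rewrite divfK.
rewrite !le_min => /and4P[t1 td0 td1 td2]; clearbody t.
pose v z := normc (A.[z] / B.[z]) ^+ 2 + eps * normc z ^+ 2.
pose u h := a0 + a1 * h + a2 * h ^+ 2.
have key (h : R[i]) : normc h = t -> B.[z0 + h] != 0 /\
    normc (u h) ^+ 2 - 2 * U * (eta * t ^+ 2) <= normc (A.[z0 + h] / B.[z0 + h]) ^+ 2.
  move=> ht; have hz : z0 + h - z0 = h by rewrite addrAC subrr add0r.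
  have Bz : B.[z0 + h] != 0.
    have := H2 (z0 + h); rewrite hz ht => /(_ ltac:(lra)).
    apply: contraTneq => ->; rewrite sub0r normcN -ltNge.
    by move: nB0; lra.
  split => //.
  have := H1 (z0 + h); rewrite hz ht => /(_ ltac:(lra)).
  rewrite -/a2; set g := A2.[_] / _ => gle.
  have -> : A.[z0 + h] / B.[z0 + h] = u h + (g - a2) * h ^+ 2.
    by rewrite E1// E2// hz -/g /u; ring.
  apply: le_trans (sqr_normcD_ge _ _); rewrite lerD2l lerN2 -!mulrA ler_pM2l//.
  rewrite ler_pM ?normc_ge0//.
    apply: (le_trans (le_normcD _ _)); apply: lerD; last first.
      by rewrite normcM normcX ht ler_piMr ?normc_ge0// expr_le1 ?ltW//; lra.
    apply: (le_trans (le_normcD _ _)); apply: lerD => //.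
    by rewrite normcM ht ler_piMr ?normc_ge0//; lra.
  by rewrite normcM normcX ht ler_wpM2r// sqr_ge0.
have nt : normc t%:C = t by rewrite normc_real gtr0_norm.
have nit : normc ('i * t%:C) = t.
  by rewrite normcM nt /= expr0n expr1n add0r sqrtr1 mul1r.
have k1 := key t%:C nt; have k2 := key (- t%:C); rewrite normcN in k2.
have {}k2 := k2 nt; have k3 := key ('i * t%:C) nit.
have k4 := key (- ('i * t%:C)); rewrite normcN in k4; have {}k4 := k4 nit.
have S := sum4_sqr_normc a0 a1 a2 t.
have T := sum4_sqr_normc z0 1 0 t.
rewrite !mul1r !mul0r !addr0 normc1 expr1n mul1r in T.
have zero : normc (0 : R[i]) ^+ 2 * t ^+ 4 = 0.
  by have /eqP -> : normc (0 : R[i]) == 0; rewrite ?normc_eq0// expr0n mul0r.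
rewrite zero addr0 in T.
case: k1 k2 k3 k4 => [n1 k1] [n2 k2] [n3 k3] [n4 k4].
have goal h : normc h = t -> B.[z0 + h] != 0 -> v z0 < v (z0 + h) ->
   exists2 z, normc (z - z0) < d0 & B.[z] != 0 /\ v z0 < v z.
  move=> ht Bh vh; exists (z0 + h) => //.
  by rewrite addrAC subrr add0r ht; lra.
have [l1|l1] := ltP (v z0) (v (z0 + t%:C)); first exact: goal l1.
have [l2|l2] := ltP (v z0) (v (z0 + - t%:C)).
  by apply: goal l2 => //; rewrite normcN.
have [l3|l3] := ltP (v z0) (v (z0 + 'i * t%:C)); first exact: goal l3.
have [l4|l4] := ltP (v z0) (v (z0 + - ('i * t%:C))).
  by apply: goal l4 => //; rewrite normcN.
exfalso.
have pos1 : 0 <= normc a1 ^+ 2 * t ^+ 2 by rewrite mulr_ge0// sqr_ge0.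
have pos2 : 0 <= normc a2 ^+ 2 * t ^+ 4 by rewrite mulr_ge0// ?sqr_ge0// exprn_ge0// ltW.
have small : 2 * U * (eta * t ^+ 2) < eps * t ^+ 2.
  rewrite mulrA ltr_pM2r ?exprn_gt0// etaE mulrA ltr_pdivrMr; last by lra.
  have := mulr_ge0 U0 (ltW eps0); lra.
have vT : eps * (normc (z0 + t%:C) ^+ 2 + normc (z0 - t%:C) ^+ 2 +
   normc (z0 + 'i * t%:C) ^+ 2 + normc (z0 - 'i * t%:C) ^+ 2) =
   eps * (4 * normc z0 ^+ 2 + 4 * t ^+ 2) by rewrite T; ring.
rewrite !mulrDr in vT.
rewrite /u in k1 k2 k3 k4.
move: l1 l2 l3 l4; rewrite /v -/a0; lra.
Qed.

(** If |A/B| exceeded 1 somewhere, then |A/B|^2 + eps |z|^2 would exceed its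
    boundary values there for eps small, and would have an interior maximum. *)
Lemma annulus_maximum_modulus A B (r1 r2 : R) : 0 < r1 ->
  (forall z, r1 <= normc z <= r2 -> B.[z] != 0) ->
  (forall z, normc z = r1 \/ normc z = r2 -> normc (A.[z] / B.[z]) <= 1) ->
  forall z, r1 <= normc z <= r2 -> normc (A.[z] / B.[z]) <= 1.
Proof.
move=> r10 B0 bd z1 z1r; rewrite leNgt; apply/negP => G1.
have r20 : 0 < r2 by case/andP: z1r => h1 h2; exact: lt_le_trans r10 (le_trans h1 h2).
pose K : set (R * R) := [set w | r1 <= normc (w.1 +i* w.2) <= r2].
have contn : continuous (fun w : R * R => normc (w.1 +i* w.2) : R).
  move=> w; apply: (continuous_comp (@continuous_complex R w)).
  exact: continuous_normc.
have clK : closed K.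
  rewrite (_ : K = (fun w : R * R => normc (w.1 +i* w.2)) @^-1` `[r1, r2]%classic).
    by apply: preimage_closed => //; exact: interval_closed.
  by apply/seteqP; split=> w; rewrite /K /= in_itv.
have cK : compact K.
  apply: (@subclosed_compact _ _ (`[- r2, r2] `*` `[- r2, r2])) => //.
    by apply: compact_setX; exact: segment_compact.
  move=> w /= /andP[_ wr]; rewrite !in_itv /= -!ler_norml.
  by split; apply: le_trans wr; [exact: (Re_le_normc (w.1 +i* w.2))
                                |exact: (Im_le_normc (w.1 +i* w.2))].
set g1 := normc (A.[z1] / B.[z1]) in G1.
(* on the annulus eps |z|^2 is at most half of the excess g1^2 - 1 *)
pose eps := (g1 ^+ 2 - 1) / (2 * r2 ^+ 2).
have g12 : 0 < g1 ^+ 2 - 1 by rewrite subr_gt0 exprn_egt1.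
have eps0 : 0 < eps by rewrite divr_gt0// mulr_gt0// exprn_gt0.
pose v z := normc (A.[z] / B.[z]) ^+ 2 + eps * normc z ^+ 2.
have cv w : K w -> {for w, continuous (fun w : R * R => v (w.1 +i* w.2))}.
  move=> Kw.
  have cc : {for w, continuous (fun w : R * R => normc (w.1 +i* w.2) : R)} := @contn w.
  have c1 := differentiable_continuous (differentiable_ratio A (B0 _ Kw)).
  have c2 := continuous_comp (@continuous_complex R w) c1.
  have c3 := continuous_comp c2 (@continuous_normc R _).
  by apply: cvgD; [|apply: cvgMr]; apply: cvgM.
have [||w] := @compact_EVT_max _ R (fun w : R * R => v (w.1 +i* w.2)) K _ cK.
- by exists (Re z1, Im z1); rewrite /K /=; case: (z1) z1r.
- by apply: continuous_in_subspaceT => w; rewrite inE; exact: cv.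
rewrite inE => Kw wmax.
have wz1 : v z1 <= v (w.1 +i* w.2).
  have := wmax (Re z1, Im z1); rewrite inE /K /=.
  by case: (z1) z1r => x y /= h; apply.
set z0 := w.1 +i* w.2 in Kw wz1 wmax.
have vz1 : 1 + eps * r2 ^+ 2 < v z0.
  apply: lt_le_trans wz1; rewrite /v -/g1.
  have -> : eps * r2 ^+ 2 = (g1 ^+ 2 - 1) / 2.
    by rewrite /eps; field; rewrite gt_eqF.
  have : 0 <= eps * normc z1 ^+ 2 by rewrite mulr_ge0 ?sqr_ge0// ltW.
  lra.
have vbd z : normc z <= r2 -> normc (A.[z] / B.[z]) <= 1 -> v z <= 1 + eps * r2 ^+ 2.
  move=> zr zG; apply: lerD; first by rewrite expr_le1// normc_ge0.
  by rewrite ler_pM2l// lerXn2r ?nnegrE ?normc_ge0// ltW.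
have ne s : s = r1 \/ s = r2 -> normc z0 != s.
  move=> sr; apply/eqP => E; move: vz1; apply/negP; rewrite -leNgt.
  apply: vbd; first by case/andP: Kw.
  by apply: bd; rewrite E.
case/andP: (Kw) => k1 k2.
have k1' : r1 < normc z0 by rewrite lt_neqAle k1 eq_sym ne//; left.
have k2' : normc z0 < r2 by rewrite lt_neqAle k2 ne//; right.
pose d0 := Num.min (normc z0 - r1) (r2 - normc z0).
have d00 : 0 < d0 by rewrite lt_min !subr_gt0 k1'.
have [z zd [Bz vz]] := ratio_no_local_max A (B0 _ Kw) eps0 d00.
move: zd; rewrite lt_min => /andP[zd1 zd2].
have t1 : normc z <= normc (z - z0) + normc z0 by rewrite -{1}[z](subrK z0) le_normcD.
have t2 : normc z0 <= normc (z - z0) + normc z.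
  by rewrite normcB -{1}[z0](subrK z) le_normcD.
have zE : Re z +i* Im z = z by case: (z).
have zK : (Re z, Im z) \in K.
  rewrite inE; change (r1 <= normc (Re z +i* Im z) <= r2).
  by rewrite zE; apply/andP; split; lra.
have := wmax _ zK; change (v (Re z +i* Im z) <= v z0 -> False).
by rewrite zE leNgt vz.
Qed.

End MaximumModulus.

(** * Boundary decay of a rational self-map of the bidisc *)

Section InnerFunction.
Variable R : realType.
Implicit Types (p : {poly {poly R[i]}}).

Lemma bidiscE (z : Cplx2 R) : bidisc R z <-> normc z.1 < 1 /\ normc z.2 < 1.
Proof.
have one : (1 : R[i]) = 1%:C by [].
by rewrite /bidisc /= !normE one !ltcR.
Qed.

Lemma closed_bidiscE (z : Cplx2 R) :
  closed_bidisc R z <-> normc z.1 <= 1 /\ normc z.2 <= 1.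
Proof.
have one : (1 : R[i]) = 1%:C by [].
by rewrite /closed_bidisc /= !normE one !lecR.
Qed.

Lemma slice_poly p (a b : R[i]) :
  exists q : {poly R[i]}, forall l, q.[l] = peval p (l * a, l * b).
Proof.
elim/poly_ind: p => [|p c [q qE]].
  by exists 0 => l; rewrite /peval !horner0.
exists (q * (a *: 'X) + (c \Po (b *: 'X))) => l.
rewrite /peval /= hornerMXaddC !hornerD !hornerM hornerC qE.
by rewrite horner_comp !hornerZ !hornerX /peval /= (mulrC l a) (mulrC l b).
Qed.

Lemma one_sub_expr_le (x : R) n : 0 <= x <= 1 -> 1 - x ^+ n <= n%:R * (1 - x).
Proof.
move=> /andP[x0 x1]; elim: n => [|n ih]; first by rewrite expr0 subrr mul0r.
have xn : x ^+ n <= 1 by exact: exprn_ile1.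
have xn0 : 0 <= x ^+ n by rewrite exprn_ge0.
rewrite exprSr -natr1 mulrDl mul1r.
apply: le_trans (lerD ih (lexx _)).
have -> : 1 - x ^+ n * x = 1 - x ^+ n + x ^+ n * (1 - x) by ring.
by rewrite lerD2l ler_piMl// subr_ge0.
Qed.

Lemma exists_expr_le (q : R) : 0 <= q -> q < 1 ->
  exists2 n, (0 < n)%N & 2 * q ^+ n <= 1.
Proof.
move=> q0 q1; have nq : `|q| < 1 by rewrite ger0_norm.
have /cvgrPdist_lt/(_ 1 ltr01)[n _ /(_ n.+1 (leqnSn n)) /=] := cvg_geometric 2 nq.
rewrite sub0r normrN ger0_norm ?mulr_ge0 ?exprn_ge0// => h.
by exists n.+1 => //; exact: ltW.
Qed.

Lemma continuous_cplx2_of : continuous (@cplx2_of R).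
Proof.
move=> w.
have c1 : {for w, continuous (fun w : (R * R) * (R * R) => w.1.1 +i* w.1.2 : Cplx R)}.
  exact: (continuous_comp (@cvg_fst _ _ _ _ _) (@continuous_complex R w.1)).
have c2 : {for w, continuous (fun w : (R * R) * (R * R) => w.2.1 +i* w.2.2 : Cplx R)}.
  exact: (continuous_comp (@cvg_snd _ _ _ _ _) (@continuous_complex R w.2)).
exact: cvg_pair c1 c2.
Qed.

(** The power N absorbs the factor 2 that 1/l costs on |l| = 1/2. Both the
    inner radius and the bound q are the same for all complex lines through the
    origin, so c does not depend on the line. *)
Lemma one_sub_inner_ge p : stable p ->
  let phi := rational_inner p in
  holomorphic_map (bidisc R) (bidisc R) (fun z => (phi z, phi z)) ->
  exists2 c : R, 0 < c & forall z, bidisc R z ->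
    c * ((1 - normc z.1) * (1 - normc z.2)) <= 1 - normc (phi z).
Proof.
move=> st phi [dPhi bPhi].
have phi1 z : bidisc R z -> normc (phi z) < 1.
  by move=> /bPhi /bidiscE[].
have cphi z : bidisc R z -> {for z, continuous (phi : Cplx2 R -> Cplx R)}.
  move=> /dPhi /differentiable_continuous cP.
  exact: (continuous_comp cP (@cvg_fst _ _ _ _ _)).
pose I : set R := `[- (1 / 2), 1 / 2]%classic.
pose K : set ((R * R) * (R * R)) := (I `*` I) `*` (I `*` I).
have cK : compact K by apply: compact_setX; apply: compact_setX; exact: segment_compact.
have K0 : K !=set0.
  by exists ((0, 0), (0, 0)); split; split; rewrite /I /= in_itv /=; apply/andP; split; lra.
have half (x y : R) : I x -> I y -> normc (x +i* y) < 1.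
  rewrite /I /= !in_itv /= => /andP[x1 x2] /andP[y1 y2].
  rewrite -(@ltr_pXn2r _ 2)// ?nnegrE ?normc_ge0//= expr1n.
  rewrite (sqr_normcE (x +i* y)) /=; nra.
have Kb w : K w -> bidisc R (cplx2_of w).
  by move=> [[? ?] [? ?]]; apply/bidiscE; split; exact: half.
have [|w] := @compact_EVT_max _ R (fun w => normc (phi (cplx2_of w))) K K0 cK.
  apply: continuous_in_subspaceT => w; rewrite inE => Kw.
  have c1 := continuous_comp (@continuous_cplx2_of w) (cphi _ (Kb _ Kw)).
  exact: (continuous_comp c1 (@continuous_normc R _)).
rewrite inE => Kw wmax; set q := normc _ in wmax.
have q0 : 0 <= q by exact: normc_ge0.
have q1 : q < 1 by exact/phi1/Kb.
have phiq (z : Cplx2 R) : normc z.1 <= 1 / 2 -> normc z.2 <= 1 / 2 -> normc (phi z) <= q.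
  case: z => [[x1 y1] [x2 y2]] h1 h2.
  have := wmax ((x1, y1), (x2, y2)); rewrite inE; apply.
  have a1 := le_trans (Re_le_normc (x1 +i* y1)) h1.
  have a2 := le_trans (Im_le_normc (x1 +i* y1)) h1.
  have a3 := le_trans (Re_le_normc (x2 +i* y2)) h2.
  have a4 := le_trans (Im_le_normc (x2 +i* y2)) h2.
  by split; split; rewrite /I /= in_itv /= -ler_norml.
have [N N0 qN] := exists_expr_le q0 q1.
exists (Num.min (1 - q) (N%:R^-1)).
  by rewrite lt_min subr_gt0 q1 invr_gt0 ltr0n.
move=> z bz; have /bidiscE[z1 z2] := bz.
have n1 := normc_ge0 z.1; have n2 := normc_ge0 z.2.
pose m := Num.max (normc z.1) (normc z.2).
have m1 : normc z.1 <= m by rewrite le_max lexx.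
have m2 : normc z.2 <= m by rewrite le_max lexx orbT.
have mlt : m < 1 by rewrite gt_max z1 z2.
have prodm : (1 - normc z.1) * (1 - normc z.2) <= 1 - m.
  rewrite /m; case: (leP (normc z.1) (normc z.2)) => _.
    by rewrite ler_piMl ?subr_ge0 ?(ltW z2)// lerBlDr lerDl.
  by rewrite ler_piMr ?subr_ge0 ?(ltW z1)// lerBlDr lerDl.
have prod0 : 0 <= (1 - normc z.1) * (1 - normc z.2) by rewrite mulr_ge0// subr_ge0 ltW.
clearbody m.
have [mh|mh] := leP m (1 / 2).
  have := phiq z (le_trans m1 mh) (le_trans m2 mh) => hq.
  have c1 : Num.min (1 - q) N%:R^-1 <= 1 - q by rewrite ge_min lexx.
  apply: (le_trans (ler_wpM2r prod0 c1)).
  have : (1 - q) * ((1 - normc z.1) * (1 - normc z.2)) <= 1 - q.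
    by apply: ler_piMr; [rewrite subr_ge0 ltW|lra].
  by lra.
have m0 : 0 < m by lra.
pose mc : R[i] := m%:C.
have mc0 : mc != 0 by rewrite -normc_eq0 normc_real normr_eq0 gt_eqF.
have nmc : normc mc = m by rewrite normc_real gtr0_norm.
have [Q QE] := slice_poly p (z.1 / mc) (z.2 / mc).
have [P PE] := slice_poly (reflection p) (z.1 / mc) (z.2 / mc).
pose zl (l : R[i]) : Cplx2 R := (l * (z.1 / mc), l * (z.2 / mc)).
have nzl l : normc (zl l).1 <= normc l /\ normc (zl l).2 <= normc l.
  rewrite /zl /= !normcM normcV nmc; split.
    by rewrite ler_piMr ?normc_ge0// ler_pdivrMr// mul1r.
  by rewrite ler_piMr ?normc_ge0// ler_pdivrMr// mul1r.
have ratio l : P.[l] / Q.[l] = phi (zl l) by rewrite PE QE.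
have Q0 l : normc l <= 1 -> Q.[l] != 0.
  move=> l1; rewrite QE; apply: (st (zl l)); apply/closed_bidiscE.
  by case: (nzl l) => h1 h2; split; apply: le_trans l1.
have s_le (r : R) : m < r -> r < 1 -> r * normc (phi z) ^+ N <= m.
  move=> mr r1; have r0 : 0 < r := lt_trans m0 mr.
  (* r phi^N / l, scaled to have modulus at most 1 on the outer circle *)
  pose A := (r%:C)%:P * P ^+ N; pose B := 'X * Q ^+ N.
  have AB l : normc l <= 1 -> normc (A.[l] / B.[l]) = r * normc (phi (zl l)) ^+ N / normc l.
    move=> l1; rewrite -ratio -normcX /A /B !hornerE ?horner_exp !normcM !normcX !normcV.
    rewrite !normcM !normcX normc_real gtr0_norm// normcV.
    by rewrite invfM expr_div_n; ring.
  have zlm : zl mc = z by rewrite /zl !(mulrC mc) !divfK//; case: (z).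
  have Em : normc (A.[mc] / B.[mc]) = r * normc (phi z) ^+ N / m.
    by rewrite AB nmc ?zlm// ltW.
  have r12 : 0 < 1 / 2 :> R by lra.
  rewrite -[leRHS]mul1r -ler_pdivrMr// -Em.
  apply: (@annulus_maximum_modulus R A B _ r r12); rewrite ?nmc.
  - move=> l /andP[l1 l2]; rewrite /B !hornerE ?horner_exp mulf_neq0//.
      by rewrite -normc_eq0 gt_eqF//; lra.
    by rewrite expf_neq0// Q0//; lra.
  - move=> l lr; have l1 : normc l <= 1 by case: lr => ->; lra.
    rewrite AB// ler_pdivrMr ?mul1r; last by case: lr => ->; lra.
    have [nz1 nz2] := nzl l; case: lr => lE.
      have h : normc (phi (zl l)) ^+ N <= q ^+ N.
        by rewrite lerXn2r ?nnegrE ?normc_ge0// phiq// -lE.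
      rewrite lE; have := exprn_ge0 N (normc_ge0 (phi (zl l))); nra.
    rewrite lE; apply: ler_piMr; first exact: ltW.
    apply: exprn_ile1; first exact: normc_ge0.
    apply/ltW/phi1; apply/bidiscE; split; apply: le_lt_trans r1; rewrite -lE; [exact: nz1|exact: nz2].
  - by apply/andP; split; lra.
have s1 : normc (phi z) <= 1 by exact/ltW/phi1.
have sm : normc (phi z) ^+ N <= m.
  rewrite leNgt; apply/negP; set s := _ ^+ N in s_le * => ms.
  have s0 : 0 < s := lt_trans m0 ms.
  have sle1 : s <= 1 by rewrite /s expr_le1 ?normc_ge0.
  have t1 : m / s < 1 by rewrite ltr_pdivrMr// mul1r.
  have t2 : m <= m / s by rewrite ler_pdivlMr// ler_piMr// ltW.
  (* any radius strictly between m/s and 1 contradicts r s <= m *)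
  have := s_le ((1 + m / s) / 2) ltac:(lra) ltac:(lra).
  have -> : (1 + m / s) / 2 * s = (s + m) / 2 by field; rewrite gt_eqF.
  by lra.
have h := one_sub_expr_le N (introT andP (conj (normc_ge0 (phi z)) s1)).
have c2 : Num.min (1 - q) N%:R^-1 <= N%:R^-1 by rewrite ge_min lexx orbT.
apply: (le_trans (ler_wpM2r prod0 c2)).
by rewrite ler_pdivrMl ?ltr0n//; lra.
Qed.

End InnerFunction.

(** * Open sets of R^4 are measurable for the product sigma-algebra *)

Section BorelProduct.

(** A countable base of neighbourhoods made of sets of m. The family m is kept
    apart from any measurable structure because topology and measurability
    live on two different names of the real line. *)
Definition measurable_base (T : topologicalType) (m : set (set T)) :=
  exists B : nat -> set T, (forall n, m (B n)) /\
    forall x U, nbhs x U -> exists2 n, B n x & B n `<=` U.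

Lemma measurable_base_prod (T1 T2 : topologicalType) (m1 : set (set T1))
    (m2 : set (set T2)) (m : set (set (T1 * T2)%type)) :
  (forall A B, m1 A -> m2 B -> m (A `*` B)) ->
  measurable_base m1 -> measurable_base m2 -> measurable_base m.
Proof.
move=> mX [B1 [mB1 b1]] [B2 [mB2 b2]].
pose dec n : nat * nat := odflt (0, 0)%N (unpickle n).
exists (fun n => B1 (dec n).1 `*` B2 (dec n).2); split; first by move=> n; exact: mX.
move=> x U [[U1 U2] /= [/b1[n1 n1x n1U] /b2[n2 n2x n2U]] UU].
exists (pickle (n1, n2)); rewrite /dec pickleK /=; first by split.
by move=> y [y1 y2]; apply: UU; split; [exact: n1U|exact: n2U].
Qed.

Lemma measurable_base_open (T : topologicalType) (m : set (set T)) (U : set T) :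
  (forall (F : nat -> set T) (P : set nat),
     (forall n, P n -> m (F n)) -> m (\bigcup_(n in P) F n)) ->
  measurable_base m -> open U -> m U.
Proof.
move=> mU [B [mB bB]] oU.
rewrite (_ : U = \bigcup_(n in [set n | B n `<=` U]) B n); first exact: mU.
apply/seteqP; split=> x /=.
  move=> Ux; have [n nx nU] := bB x U (open_nbhs_nbhs (conj oU Ux)).
  by exists n.
by move=> [n nU nx]; exact: nU.
Qed.

Variable R : realType.

Lemma measurable_base_real :
  measurable_base (T := R) (@measurable _ (measurableTypeR R)).
Proof.
pose dec n : rat * rat := odflt (0, 0) (unpickle n).
exists (fun n => `]ratr (dec n).1, ratr (dec n).2[%classic); split.
  by move=> n; exact: measurable_itv.
move=> x U /nbhs_ballP[e /= e0 eU].
have [a] : exists q, ratr q \in `]x - e, x[ by apply: rat_in_itvoo; rewrite ltrBlDr ltrDl.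
rewrite in_itv /= => /andP[a1 a2].
have [b] : exists q, ratr q \in `]x, x + e[ by apply: rat_in_itvoo; rewrite ltrDl.
rewrite in_itv /= => /andP[b1 b2].
exists (pickle (a, b)); rewrite /dec pickleK /=.
  by rewrite in_itv /= a2 b1.
move=> y /=; rewrite in_itv /= => /andP[y1 y2]; apply: eU.
by rewrite /ball /= ltr_norml; apply/andP; split; lra.
Qed.

Local Notation MR := (measurableTypeR R).

Lemma open_measurable4 (U : set ((R * R) * (R * R))) : open U ->
  measurable (U : set ((MR * MR) * (MR * MR))).
Proof.
apply: measurable_base_open; first by move=> F P; exact: bigcup_measurable.
have b2 : measurable_base (T := (R * R)%type) (@measurable _ (MR * MR)%type).
  apply: (measurable_base_prod _ measurable_base_real measurable_base_real).
  by move=> A B mA mB; exact: measurableX.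
apply: (measurable_base_prod _ b2 b2).
by move=> A B mA mB; exact: measurableX.
Qed.

Lemma continuous_measurable4 (U : set ((R * R) * (R * R)))
    (F : (R * R) * (R * R) -> R) :
  open U -> (forall w, U w -> {for w, continuous F}) ->
  measurable_fun (U : set ((MR * MR) * (MR * MR))) (F : _ -> MR).
Proof.
move=> oU cF mU; apply: (measurability _ (RGenOInfty.measurableE R)) => //.
move=> /= _ [_ [x ->] <-]; apply: open_measurable4.
rewrite openE => w [Uw]; rewrite /= in_itv /= andbT => xw.
apply: filterI; first exact: open_nbhs_nbhs.
have := cF w Uw; move=> /cvgr_gt/(_ _ xw); apply: filterS => v /=.
by rewrite in_itv /= andbT.
Qed.

End BorelProduct.

(** * Point evaluations on the weighted Bergman space *)

Section PointEvaluation.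
Variable R : realType.
Notation leb := (@lebesgue_measure R).
Local Notation MR := (measurableTypeR R).
Local Notation bidisc4 := (@cplx2_of R @^-1` bidisc R).

(** Planar Lebesgue measure under a name of its own, to which its
    sigma-finiteness is attached; Tonelli's theorem on R^2 x R^2 asks for it. *)
Definition plane_measure : set (MR * MR) -> \bar R := (leb \x leb)%E.

HB.instance Definition _ := Measure.copy plane_measure (leb \x leb)%E.

Let plane_measure_sigma_finite : sigma_finite setT plane_measure.
Proof.
have /sigma_finiteP[F [UF ndF F_fin]] := sigma_finiteT leb.
exists (fun n => F n `*` F n).
  apply/esym; rewrite -subTset => -[x y] _.
  have [[n _ Fx] [k _ Fy]] : (\bigcup_n F n) x /\ (\bigcup_n F n) y by rewrite -UF.
  exists (maxn n k) => //; split.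
    by move: x Fx; exact/subsetPset/ndF/leq_maxl.
  by move: y Fy; exact/subsetPset/ndF/leq_maxr.
move=> n; have [mF Fn] := F_fin n; split; first exact: measurableX.
by rewrite /plane_measure product_measure1E// lte_mul_pinfty// ge0_fin_numE.
Qed.

HB.instance Definition _ :=
  Measure_isSigmaFinite.Build _ _ _ plane_measure plane_measure_sigma_finite.

Definition bergman_integrand (beta : R) (f : Cplx2 R -> Cplx R) (w : (R * R) * (R * R)) : R :=
  normc (f (cplx2_of w)) ^+ 2 * weight beta (cplx2_of w).

Lemma bergman_integrand_ge0 beta f w : 0 <= bergman_integrand beta f w.
Proof. by rewrite mulr_ge0 ?sqr_ge0// mulr_ge0// powR_ge0. Qed.

Lemma continuous_normc1 : continuous (fun w : (R * R) * (R * R) => normc (cplx2_of w).1 : R).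
Proof.
move=> w.
have c2 : {for w, continuous (fun w : (R * R) * (R * R) => (cplx2_of w).1 : Cplx R)}.
  exact: (continuous_comp (@continuous_cplx2_of R w) (@cvg_fst _ _ _ _ _)).
exact: (continuous_comp c2 (@continuous_normc R _)).
Qed.

Lemma continuous_normc2 : continuous (fun w : (R * R) * (R * R) => normc (cplx2_of w).2 : R).
Proof.
move=> w.
have c2 : {for w, continuous (fun w : (R * R) * (R * R) => (cplx2_of w).2 : Cplx R)}.
  exact: (continuous_comp (@continuous_cplx2_of R w) (@cvg_snd _ _ _ _ _)).
exact: (continuous_comp c2 (@continuous_normc R _)).
Qed.

Lemma open_bidisc4 : open (bidisc4 : set ((R * R) * (R * R))).
Proof.
rewrite (_ : bidisc4 = ((fun w => normc (cplx2_of w).1) @^-1` [set x : R | x < 1]) `&`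
                       ((fun w => normc (cplx2_of w).2) @^-1` [set x : R | x < 1])).
  by apply: openI; apply: open_comp; [move=> w _; exact: continuous_normc1|exact: open_lt
    |move=> w _; exact: continuous_normc2|exact: open_lt].
by apply/seteqP; split=> w /bidiscE.
Qed.

Lemma measurable_bidisc4 : measurable (bidisc4 : set ((MR * MR) * (MR * MR))).
Proof. exact: open_measurable4 open_bidisc4. Qed.

Lemma measurable_bergman_integrand (beta : R) (f : Cplx2 R -> Cplx R) :
  (forall z, bidisc R z -> differentiable f z) ->
  measurable_fun (bidisc4 : set ((MR * MR) * (MR * MR)))
    (EFin \o bergman_integrand beta f).
Proof.
move=> df; apply/measurable_EFinP.
have mU := measurable_bidisc4.
have mf : measurable_fun (bidisc4 : set ((MR * MR) * (MR * MR)))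
    ((fun w => normc (f (cplx2_of w))) : _ -> MR).
  apply: (continuous_measurable4 open_bidisc4) => w wU.
  have c1 := continuous_comp (@continuous_cplx2_of R w) (differentiable_continuous (df _ wU)).
  exact: (continuous_comp c1 (@continuous_normc R _)).
have m1 : measurable_fun (bidisc4 : set ((MR * MR) * (MR * MR)))
    ((fun w => normc (cplx2_of w).1) : _ -> MR).
  by apply: (continuous_measurable4 open_bidisc4) => w _; exact: continuous_normc1.
have m2 : measurable_fun (bidisc4 : set ((MR * MR) * (MR * MR)))
    ((fun w => normc (cplx2_of w).2) : _ -> MR).
  by apply: (continuous_measurable4 open_bidisc4) => w _; exact: continuous_normc2.
apply: measurable_funM; first exact: measurable_funX.
apply: measurable_funM.
  apply: (measurableT_comp (measurable_powR _)).
  by apply: measurable_funB => //; exact: measurable_funX.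
apply: (measurableT_comp (measurable_powR _)).
by apply: measurable_funB => //; exact: measurable_funX.
Qed.

Lemma slice1_differentiable (f : Cplx2 R -> Cplx R) (z1 z2 : Cplx R) :
  differentiable f (z1, z2) -> differentiable (fun z : Cplx R => f (z, z2)) z1.
Proof.
move=> df; apply: (@differentiable_comp _ _ _ _ (fun z : Cplx R => (z, z2)) f) => //.
Qed.

Lemma slice2_differentiable (f : Cplx2 R -> Cplx R) (z1 z2 : Cplx R) :
  differentiable f (z1, z2) -> differentiable (fun z : Cplx R => f (z1, z)) z2.
Proof.
move=> df; apply: (@differentiable_comp _ _ _ _ (fun z : Cplx R => (z1, z)) f) => //.
Qed.

(** A square of half-side d/4 reaches at most d/2 from its centre, hence stays
    away from the unit circle by half the distance of the centre. *)
Lemma square_in_disc (a1 a2 x y d : R) : 1 - normc (a1 +i* a2) = d ->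
  `|x - a1| <= d / 4 -> `|y - a2| <= d / 4 -> normc (x +i* y) <= 1 - d / 2.
Proof.
move=> dE hx hy.
have -> : x +i* y = (a1 +i* a2) + ((x - a1) +i* (y - a2)) by simpc; congr (_ +i* _); ring.
apply: (le_trans (le_normcD _ _)).
have := normc_le_Re_Im (x - a1) (y - a2); lra.
Qed.

(** The mean value inequality in the second variable, then in the first, over
    squares on which 1 - |z|^2 is at least half the distance from the centre to
    the unit circle. *)
Lemma bergman_point_evaluation (alpha : R) (f : Cplx2 R -> Cplx R) (a b : R[i]) (da db : R) :
  0 <= alpha -> (forall z, bidisc R z -> differentiable f z) ->
  1 - normc a = da -> 0 < da -> 1 - normc b = db -> 0 < db ->
  ((((da / 2) `^ alpha * (db / 2) `^ alpha) * ((db / 4) ^+ 2 / 4) *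
     normc (f (a, b)) ^+ 2 * ((da / 4) ^+ 2 / 4))%:E <=
   \int[plane_measure \x plane_measure]_(w in bidisc4) (bergman_integrand alpha f w)%:E)%E.
Proof.
move=> al0 df; case: a => a1 a2 daE da0; case: b => b1 b2 dbE db0.
set W := (da / 2) `^ alpha * (db / 2) `^ alpha.
have W0 : 0 <= W by rewrite mulr_ge0// powR_ge0.
pose G : (MR * MR) * (MR * MR) -> \bar R := (EFin \o bergman_integrand alpha f) \_ bidisc4.
have mG : measurable_fun setT G.
  apply/(measurable_restrictT _ _).1; first exact: measurable_bidisc4.
  exact: measurable_bergman_integrand.
have G0 w : (0 <= G w)%E.
  by apply: erestrict_ge0 => v _; rewrite lee_fin bergman_integrand_ge0.
pose G1 (w : MR * MR) : \bar R := (\int[plane_measure]_v G (w, v))%E.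
have mG1 : measurable_fun setT G1.
  exact: (@measurable_fun_fubini_tonelli_F _ _ (MR * MR)%type (MR * MR)%type R plane_measure G mG G0).
have G10 w : (0 <= G1 w)%E by exact: integral_ge0.
have -> : (\int[plane_measure \x plane_measure]_(w in bidisc4) (bergman_integrand alpha f w)%:E =
   \int[plane_measure]_w G1 w)%E.
  transitivity (\int[plane_measure \x plane_measure]_w G w)%E; first exact: integral_mkcond.
  exact: (@fubini_tonelli1 _ _ (MR * MR)%type (MR * MR)%type R plane_measure plane_measure G mG G0).
have inD (c1 c2 x y d : R) : 1 - normc (c1 +i* c2) = d -> 0 < d ->
    `|x - c1| <= d / 4 -> `|y - c2| <= d / 4 -> normc (x +i* y) < 1.
  by move=> dE d0 hx hy; have := square_in_disc dE hx hy; lra.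
have wd (c1 c2 x y d : R) : 1 - normc (c1 +i* c2) = d -> 0 < d ->
    `|x - c1| <= d / 4 -> `|y - c2| <= d / 4 ->
    (d / 2) `^ alpha <= (1 - normc (x +i* y) ^+ 2) `^ alpha.
  move=> dE d0 hx hy; have h := square_in_disc dE hx hy.
  have n0 := normc_ge0 (x +i* y); move: (normc _) h n0 => n h n0.
  have n2 : n ^+ 2 <= n by rewrite expr2 ler_piMr//; lra.
  by rewrite ge0_ler_powR// ?nnegrE; lra.
have da4 : 0 < da / 4 by rewrite divr_gt0.
have db4 : 0 < db / 4 by rewrite divr_gt0.
have k0 : 0 <= W * ((db / 4) ^+ 2 / 4) by rewrite mulr_ge0// divr_ge0// sqr_ge0.
have bc : normc (b1 +i* b2) < 1 by lra.
apply: (@square_mean_value R (fun z => f (z, (b1 +i* b2 : Cplx R))) a1 a2) => //.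
  move=> x y hx hy; apply: slice1_differentiable; apply: df; apply/bidiscE; split => //=.
  exact: inD hx hy.
move=> x y hx hy.
have -> : W * ((db / 4) ^+ 2 / 4) * normc (f (x +i* y, b1 +i* b2)) ^+ 2 =
  W * normc (f (x +i* y, b1 +i* b2)) ^+ 2 * ((db / 4) ^+ 2 / 4) by ring.
apply: (@square_mean_value R (fun z => f ((x +i* y : Cplx R), z)) b1 b2) => //.
- move=> x' y' hx' hy'; apply: slice2_differentiable; apply: df; apply/bidiscE.
  by split; [exact: inD hx hy|exact: inD hx' hy'].
- by apply: (measurableT_comp mG); exact: measurable_pair1.
move=> x' y' hx' hy'; rewrite /G /patch mem_set; last first.
  by apply/bidiscE; split; [exact: inD hx hy|exact: inD hx' hy'].
rewrite lee_fin /bergman_integrand mulrC ler_wpM2l ?sqr_ge0// /weight /W.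
by apply: ler_pM; rewrite ?powR_ge0//; [exact: wd hx hy|exact: wd hx' hy'].
Qed.

End PointEvaluation.

(** * Boundedness of the composition operator *)

Section CompositionOperator.
Variable R : realType.
Notation leb := (@lebesgue_measure R).
Local Notation MR := (measurableTypeR R).
Local Notation bidisc4 := (@cplx2_of R @^-1` bidisc R).

Lemma bergman_integralE (beta : R) f : bergman_integral beta f =
  ((pi ^- 2)%:E * \int[@plane_measure R \x @plane_measure R]_(w in bidisc4)
     (bergman_integrand beta f w)%:E)%E.
Proof. by []. Qed.

(** The bidisc lies in the cube [-1,1]^4 of volume 16. *)
Lemma bidisc4_integral_le (beta C : R) f : 0 <= C ->
  (forall z, bidisc R z -> normc (f z) ^+ 2 * weight beta z <= C) ->
  (\int[@plane_measure R \x @plane_measure R]_(w in bidisc4)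
     (bergman_integrand beta f w)%:E <= (16 * C)%:E)%E.
Proof.
move=> C0 fC.
pose I : set MR := `[-1, 1]%classic.
have mI : measurable I by exact: measurable_itv.
have lI : leb I = 2%:E.
  by rewrite /I /= lebesgue_measure_itv /= lte_fin gtrN ?ltr01// -EFinD opprK.
have lII : @plane_measure R (I `*` I) = 4%:E.
  rewrite /plane_measure; transitivity (leb I * leb I)%E; first exact: product_measure1E.
  by rewrite lI -EFinM -natrM.
have mII : measurable (I `*` I) by exact: measurableX.
have lK : (@plane_measure R \x @plane_measure R)%E ((I `*` I) `*` (I `*` I)) = 16%:E.
  transitivity (@plane_measure R (I `*` I) * @plane_measure R (I `*` I))%E.
    exact: product_measure1E.
  by rewrite lII -EFinM -natrM.
have mK : measurable ((I `*` I) `*` (I `*` I)) by exact: measurableX.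
have -> : (16 * C)%:E = (\int[@plane_measure R \x @plane_measure R]_(w in (I `*` I) `*` (I `*` I))
     (cst C%:E) w)%E.
  by rewrite integral_cst//= lK -EFinM mulrC.
apply: le_integral_subset.
- move=> [[x1 y1] [x2 y2]] /bidiscE /= [h1 h2].
  rewrite /I /= !in_itv /= -!ler_norml.
  have := le_lt_trans (Re_le_normc (x1 +i* y1)) h1.
  have := le_lt_trans (Im_le_normc (x1 +i* y1)) h1.
  have := le_lt_trans (Re_le_normc (x2 +i* y2)) h2.
  have := le_lt_trans (Im_le_normc (x2 +i* y2)) h2.
  by move=> /= /ltW ? /ltW ? /ltW ? /ltW ?; split; split.
- by move=> w _; rewrite lee_fin bergman_integrand_ge0.
- by move=> w _; rewrite lee_fin.
- by move=> w wU; rewrite lee_fin; exact: fC.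
Qed.

(** With h = d/2, the point evaluation reads h^beta |f(phi,phi)|^2 <= 256 I and
    the weight is at most (8/c)^beta h^beta: the powers of h cancel. *)
Lemma composition_pointwise (beta c I : R) (phi : Cplx2 R -> Cplx R)
    (f : Cplx2 R -> Cplx R) (z : Cplx2 R) :
  4 < beta -> 0 < c -> bidisc R z -> normc (phi z) < 1 ->
  c * ((1 - normc z.1) * (1 - normc z.2)) <= 1 - normc (phi z) ->
  (forall z, bidisc R z -> differentiable f z) ->
  (\int[@plane_measure R \x @plane_measure R]_(w in bidisc4)
     (bergman_integrand (beta / 2 - 2) f w)%:E)%E = I%:E ->
  normc (f (phi z, phi z)) ^+ 2 * weight beta z <= 256 * (8 / c) `^ beta * I.
Proof.
move=> b4 c0 /bidiscE[z1 z2] p1 le df IE.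
set d := 1 - normc (phi z) in le.
have d0 : 0 < d by rewrite subr_gt0.
have al0 : 0 <= beta / 2 - 2 by lra.
have := bergman_point_evaluation al0 df (erefl d) d0 (erefl d) d0.
rewrite IE lee_fin; set F := normc (f _) ^+ 2; set h := d / 2.
have F0 : 0 <= F by exact: sqr_ge0.
have h0 : 0 < h by rewrite divr_gt0.
have -> : (d / 4) ^+ 2 / 4 = h ^+ 2 / 16 by rewrite /h; field.
(* beta = 2 (beta/2 - 2) + 4 *)
have hpow : h `^ beta = h `^ (beta / 2 - 2) * h `^ (beta / 2 - 2) * (h ^+ 2 * h ^+ 2).
  rewrite -exprD -powR_mulrn ?ltW// -!powRD ?(gt_eqF h0) ?implybT//.
  by congr (_ `^ _); rewrite natrD; field.
move=> FI.
have {}FI : h `^ beta * F <= 256 * I.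
  have : h `^ beta * F / 256 <= I.
    by apply: le_trans FI; rewrite hpow le_eqVlt; apply/orP; left; apply/eqP; field.
  lra.
have n1 := normc_ge0 z.1; have n2 := normc_ge0 z.2.
have w1 : 1 - normc z.1 ^+ 2 <= 2 * (1 - normc z.1) by rewrite expr2; nra.
have w2 : 1 - normc z.2 ^+ 2 <= 2 * (1 - normc z.2) by rewrite expr2; nra.
have w10 : 0 <= 1 - normc z.1 ^+ 2 by rewrite subr_ge0 expr_le1// ltW.
have w20 : 0 <= 1 - normc z.2 ^+ 2 by rewrite subr_ge0 expr_le1// ltW.
have wle : weight beta z <= (8 / c) `^ beta * h `^ beta.
  rewrite /weight -!powRM ?(ltW h0)// ?divr_ge0 ?(ltW c0)//.
  apply: ge0_ler_powR; first lra.
  - by rewrite nnegrE mulr_ge0.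
  - by rewrite nnegrE mulr_ge0 ?(ltW h0)// divr_ge0// ltW.
  apply: (le_trans (ler_pM w10 w20 w1 w2)).
  have -> : 8 / c * h = 4 * (d / c) by rewrite /h; field; rewrite gt_eqF.
  have : (1 - normc z.1) * (1 - normc z.2) <= d / c by rewrite ler_pdivlMr// mulrC.
  lra.
apply: (le_trans (ler_wpM2l F0 wle)).
have -> : F * ((8 / c) `^ beta * h `^ beta) = (8 / c) `^ beta * (h `^ beta * F) by ring.
have -> : 256 * (8 / c) `^ beta * I = (8 / c) `^ beta * (256 * I) by ring.
by rewrite ler_wpM2l// powR_ge0.
Qed.

End CompositionOperator.

Theorem theorem2p2 (R : realType) (p : {poly {poly R[i]}}) (beta : R) :
  stable p ->
  let phi := rational_inner p in
  let Phi := fun z : Cplx2 R => (phi z, phi z) in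
  holomorphic_map (bidisc R) (bidisc R) Phi ->
  4 < beta ->
  bounded_bergman_operator (beta / 2 - 2) beta (composition_operator Phi).
Proof.
move=> st phi Phi hol b4; case: (hol) => dPhi bPhi.
have [c c0 cphi] := one_sub_inner_ge st hol.
pose C := 16 * (256 * (8 / c) `^ beta).
have C0 : 0 <= C by rewrite !mulr_ge0// powR_ge0.
have pi0 : 0 < pi ^- 2 :> R by rewrite invr_gt0 exprn_gt0// pi_gt0.
have key f : bergman (beta / 2 - 2) f -> exists I : R,
    [/\ 0 <= I, bergman_integral (beta / 2 - 2) f = I%:E &
        (bergman_integral beta (f \o Phi) <= (C * I)%:E)%E].
  move=> [[df _]]; rewrite bergman_integralE.
  set J := (\int[_]_(w in _) _)%E => Jfin.
  have J0 : (0 <= J)%E by apply: integral_ge0 => w _; rewrite lee_fin bergman_integrand_ge0.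
  have [I JE] : exists I : R, J = I%:E.
    move: J0 Jfin; case: J => [I _ _| |//]; first by exists I.
    by rewrite mulr_infty gtr0_sg// mul1e.
  rewrite JE -EFinM; have I0 : 0 <= I by rewrite -lee_fin -JE.
  exists (pi ^- 2 * I); split => //; first by rewrite mulr_ge0// ltW.
  rewrite bergman_integralE (_ : C * _ = pi ^- 2 * (16 * (256 * (8 / c) `^ beta * I))); last first.
    by rewrite /C; ring.
  rewrite EFinM lee_pmul2l//; apply: bidisc4_integral_le.
    by rewrite !mulr_ge0// powR_ge0.
  move=> z bz; apply: (composition_pointwise b4 c0 bz _ (cphi z bz) df JE).
  by have /bidiscE[] := bPhi z bz.
split.
- move=> f bf; have [I [_ _ IC]] := key f bf; case: bf => [[df _] _].
  split; last exact: le_lt_trans IC (ltry _).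
  split=> // z bz; apply: differentiable_comp; first exact: dPhi.
  exact/df/bPhi.
- by [].
- exists (Num.sqrt C) => f bf; have [I [I0 IE IC]] := key f bf.
  rewrite /bergman_norm IE /= -sqrtrM// ler_wsqrtr//.
  have B0 : (0 <= bergman_integral beta (f \o Phi))%E.
    rewrite bergman_integralE mule_ge0 ?lee_fin ?(ltW pi0)//.
    by apply: integral_ge0 => w _; rewrite lee_fin bergman_integrand_ge0.
  rewrite -lee_fin fineK// ge0_fin_numE//; exact: le_lt_trans IC (ltry _).
Qed.
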